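(* Let $G=(V,\mathcal{E},w)$ be an undirected, connected, weighted graph on $n$ nodes with Laplacian $L$ and largest Laplacian eigenvalue $\lambda_n$. Let $\tau\ge0$ with $\tau\lambda_n<\pi/2$. Consider $$\dot x(t)=-L\,x(t-\tau)+B\,\xi(t),\qquad y(t)=M_n x(t),$$ where $B\in\mathbb{R}^{n\times m}$ and $\xi=(\xi_1,\dots,\xi_m)^T$ consists of mutually independent zero-mean Gaussian white noises, $\xi_k$ with intensity $\sigma_k^2$. Then the performance $\rho_{ss}(L;\tau)$ is a function of $L$, $B$ and $\tau$ (and the $\sigma_k$). If the noise components are indexed by agents ($m=n$), then $$\rho_{ss}(L;\tau)=\sum_{i\in V}\eta_i\sigma_i^2,\qquad \eta_i=\frac12\Big[B^{T}L^{\dagger}\cos(\tau L)\big(M_n-\sin(\tau L)\big)^{\dagger}B\Big]_{ii}.$$ If the noise components are indexed by links ($m=|\mathcal E|$), then $$\rho_{ss}(L;\tau)=\sum_{e\in\mathcal E}\nu_e\sigma_e^2,\qquad \nu_e=\frac12\Big[B^{T}L^{\dagger}\cos(\tau L)\big(M_n-\sin(\tau L)\big)^{\dagger}B\Big]_{ee}.$$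
   Context: Notation: - $M_n=I_n-\frac1n\mathbf 1_n\mathbf 1_n^{T}$. - $X^{\dagger}$ is the Moore–Penrose pseudo-inverse. - $\cos(X)=\sum_{k\ge0}\frac{(-1)^kX^{2k}}{(2k)!}$ and $\sin(X)=\sum_{k\ge0}\frac{(-1)^kX^{2k+1}}{(2k+1)!}$. The performance of the network is $$\rho_{ss}(L;\tau)=\lim_{t\to\infty}\mathbb E[y(t)^Ty(t)].$$ Equivalently, $$\rho_{ss}=\frac1{2\pi}\int_{-\infty}^{\infty}\mathrm{Tr}[G(j\omega)^HG(j\omega)]d\omega,\qquad G(s)=M_n(sI_n+e^{-\tau s}L)^{-1}B\,\mathrm{diag}(\sigma_1,\dots,\sigma_m).$$ The centrality indices are $\eta_i=\partial\rho_{ss}/\partial\sigma_i^2$ (agent noise) and $\nu_e=\partial\rho_{ss}/\partial\sigma_e^2$ (link noise). *)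

(* Defs.v *)
From HB Require Import structures.
From mathcomp Require Import all_boot all_order all_algebra.
From mathcomp Require Import all_classical all_reals.
From mathcomp Require Import topology normedtype sequences trigo measure
  lebesgue_measure lebesgue_integral.
From mathcomp Require Import complex.

Set Implicit Arguments.
Unset Strict Implicit.
Unset Printing Implicit Defensive.

Import Order.TTheory GRing.Theory Num.Theory.
Local Open Scope ring_scope.

Section Defs.
Variable R : realType.

Definition centering (n : nat) : 'M[R]_n :=
  1%:M - (n%:R)^-1 *: const_mx 1.

Definition is_wgraph (n : nat) (w : 'I_n -> 'I_n -> R) : Prop :=
  [/\ forall i j, w i j = w j i, forall i j, 0 <= w i j & forall i, w i i = 0].

Definition wedge (n : nat) (w : 'I_n -> 'I_n -> R) : rel 'I_n :=
  fun i j => 0 < w i j.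

Definition wconnected (n : nat) (w : 'I_n -> 'I_n -> R) : Prop :=
  forall i j, connect (wedge w) i j.

Definition laplacian (n : nat) (w : 'I_n -> 'I_n -> R) : 'M[R]_n :=
  \matrix_(i, j) ((if i == j then \sum_(k < n) w i k else 0) - w i j).

Definition largest_eigenvalue (n : nat) (A : 'M[R]_n) (l : R) : Prop :=
  eigenvalue A l /\ (forall a, eigenvalue A a -> a <= l).

(* Moore--Penrose pseudo-inverse: the (unique) matrix satisfying the four
   Penrose equations *)
Definition penrose (n : nat) (A X : 'M[R]_n) : Prop :=
  [/\ A *m X *m A = A, X *m A *m X = X,
      (A *m X)^T = A *m X & (X *m A)^T = X *m A].

Definition mp_pinv (n : nat) (A : 'M[R]_n) : 'M[R]_n := xget 0 (penrose A).

Definition mx_cos (n : nat) (X : 'M[R]_n) : 'M[R]_n :=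
  \matrix_(i, j) limn (fun N => \sum_(0 <= k < N)
     ((-1) ^+ k / ((2 * k)`!)%:R * (X ^+ (2 * k)) i j)).

Definition mx_sin (n : nat) (X : 'M[R]_n) : 'M[R]_n :=
  \matrix_(i, j) limn (fun N => \sum_(0 <= k < N)
     ((-1) ^+ k / ((2 * k).+1`!)%:R * (X ^+ (2 * k).+1) i j)).

Local Open Scope complex_scope.

Definition cmx (p q : nat) (A : 'M[R]_(p, q)) : 'M[R[i]]_(p, q) :=
  map_mx (fun x => x%:C) A.

Definition transfer (n m : nat) (L : 'M[R]_n) (B : 'M[R]_(n, m))
    (sigma : 'I_m -> R) (tau om : R) : 'M[R[i]]_(n, m) :=
  cmx (centering n) *m
  invmx ((0 +i* om) *: (1%:M : 'M[R[i]]_n)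
         + (cos (tau * om) +i* (- sin (tau * om))) *: cmx L) *m
  cmx B *m cmx (diag_mx (\row_k sigma k)).

(* Tr[G(j omega)^H G(j omega)] (a real number) *)
Definition h2_integrand (n m : nat) (L : 'M[R]_n) (B : 'M[R]_(n, m))
    (sigma : 'I_m -> R) (tau om : R) : R :=
  let G := transfer L B sigma tau om in
  complex.Re (\tr ((map_mx conjc G)^T *m G)).

Local Close Scope complex_scope.

Definition rho_ss (n m : nat) (L : 'M[R]_n) (B : 'M[R]_(n, m))
    (sigma : 'I_m -> R) (tau : R) : \bar R :=
  ((2 * pi)^-1)%:E *
  (\int[@lebesgue_measure R]_(om in [set: R])
      (h2_integrand L B sigma tau om)%:E)%E.

End Defs.

(* Main.v *)
(** The Laplacian is real symmetric, so L = sum_i l_i E_i with orthogonal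
    symmetric projections E_i, and connectedness says that the projection on the
    kernel is 1 1^T / n. Pseudo-inverses, cos, sin and the resolvent act on the l_i
    alone, which reduces the claim to the scalar integral
    int dw / (w^2 + l^2 - 2 l w sin (tau w)) = pi cos (tau l) / (l (1 - sin (tau l))),
    and by scaling to l = 1, a = tau l < pi / 2.

    Put q = cos a / (1 - sin a). The function
      F z = ((e^(-az) - z) / (e^(-az) + z) + q (z - 1) / (z + 1)) / (1 + z^2)
    is holomorphic on Re z > 0, because e^(-az) + z has no zero on Re z >= 0 when
    a < pi / 2; q is chosen so that the numerator vanishes at z = i and z = -i, hence
    F is O(1 / |z|^2) up to the imaginary axis, where
      Re (F (iw)) = 1 / (1 + w^2 - 2 w sin (a w)) - q / (1 + w^2).
    By the Cauchy-Riemann equations the integral of Re F over the line Re z = c does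
    not depend on c > 0; it tends to 0 as c grows, so the integral of the right-hand
    side above is 0. *)
Require Import Defs.
From HB Require Import structures.
From mathcomp Require Import all_boot all_order all_algebra.
From mathcomp Require Import all_classical all_reals.
From mathcomp Require Import ereal topology normedtype numfun sequences derive
  realfun exp trigo measure lebesgue_measure lebesgue_integral
  measurable_realfun ftc.
From mathcomp Require Import spectral sesquilinear complex ring lra.

Set Implicit Arguments.
Unset Strict Implicit.
Unset Printing Implicit Defensive.

Import Order.TTheory GRing.Theory Num.Theory.
Import numFieldNormedType.Exports.
Local Open Scope classical_set_scope.
Local Open Scope ring_scope.
Local Notation normc := Normc.normc.

(** * The scalar delay integral *)

Section ComplexCurves.
Variable R : realType.
Implicit Types (f g : R -> R[i]) (t : R) (d : R[i]).

(** Differentiation along a real parameter. Applying one chain rule to horizontal lines (direction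
    1) and to vertical lines (direction i) is how the Cauchy-Riemann equations enter. *)
Definition cderive f t d : Prop :=
  is_derive t 1 (fun x => complex.Re (f x)) (complex.Re d) /\
  is_derive t 1 (fun x => complex.Im (f x)) (complex.Im d).

Lemma Re_mulc (x y : R[i]) : complex.Re (x * y) =
  complex.Re x * complex.Re y - complex.Im x * complex.Im y.
Proof. by case: x y => [? ?] [? ?]. Qed.

Lemma Im_mulc (x y : R[i]) : complex.Im (x * y) =
  complex.Re x * complex.Im y + complex.Im x * complex.Re y.
Proof. by case: x y => [? ?] [? ?]. Qed.

Lemma Re_addc (x y : R[i]) : complex.Re (x + y) = complex.Re x + complex.Re y.
Proof. by case: x y => [? ?] [? ?]. Qed.

Lemma Im_addc (x y : R[i]) : complex.Im (x + y) = complex.Im x + complex.Im y.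
Proof. by case: x y => [? ?] [? ?]. Qed.

Lemma cderive_cst (z : R[i]) t : cderive (fun _ => z) t 0.
Proof. by split; apply: is_derive_cst. Qed.

Lemma cderiveD f g t df dg : cderive f t df -> cderive g t dg ->
  cderive (fun x => f x + g x) t (df + dg).
Proof.
move=> [f1 f2] [g1 g2]; split.
  rewrite (_ : (fun x => _) = (fun x => complex.Re (f x)) + (fun x => complex.Re (g x)));
    last by apply/funext => x; rewrite Re_addc.
  by rewrite Re_addc; exact: is_deriveD.
rewrite (_ : (fun x => _) = (fun x => complex.Im (f x)) + (fun x => complex.Im (g x)));
  last by apply/funext => x; rewrite Im_addc.
by rewrite Im_addc; exact: is_deriveD.
Qed.

Lemma cderiveM f g t df dg : cderive f t df -> cderive g t dg ->
  cderive (fun x => f x * g x) t (df * g t + f t * dg).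
Proof.
move=> [f1 f2] [g1 g2]; split.
  rewrite (_ : (fun x => _) = (fun x => complex.Re (f x)) * (fun x => complex.Re (g x))
      - (fun x => complex.Im (f x)) * (fun x => complex.Im (g x)));
    last by apply/funext => x; rewrite Re_mulc.
  apply: (is_derive_eq (is_deriveB (is_deriveM f1 g1) (is_deriveM f2 g2))).
  rewrite Re_addc !Re_mulc /GRing.scale /=; ring.
rewrite (_ : (fun x => _) = (fun x => complex.Re (f x)) * (fun x => complex.Im (g x))
    + (fun x => complex.Im (f x)) * (fun x => complex.Re (g x)));
  last by apply/funext => x; rewrite Im_mulc.
apply: (is_derive_eq (is_deriveD (is_deriveM f1 g2) (is_deriveM f2 g1))).
rewrite Im_addc !Im_mulc /GRing.scale /=; ring.
Qed.

Lemma sqr_ReIm_neq0 (z : R[i]) : z != 0 ->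
  complex.Re z ^+ 2 + complex.Im z ^+ 2 != 0.
Proof.
case: z => x y; rewrite eq_complex /= => xy0.
by rewrite paddr_eq0 ?sqr_ge0// !sqrf_eq0.
Qed.

Lemma cderiveV f t df : f t != 0 -> cderive f t df ->
  cderive (fun x => (f x)^-1) t (- df * (f t)^-1 ^+ 2).
Proof.
move=> ft0 [f1 f2].
have n0 := sqr_ReIm_neq0 ft0.
have ReV (z : R[i]) : complex.Re z^-1 =
    complex.Re z * (complex.Re z ^+ 2 + complex.Im z ^+ 2)^-1 by case: z.
have ImV (z : R[i]) : complex.Im z^-1 =
    - (complex.Im z * (complex.Re z ^+ 2 + complex.Im z ^+ 2)^-1) by case: z.
pose n : R -> R := (fun x => complex.Re (f x)) * (fun x => complex.Re (f x))
  + (fun x => complex.Im (f x)) * (fun x => complex.Im (f x)).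
have nE x : n x = complex.Re (f x) ^+ 2 + complex.Im (f x) ^+ 2.
  by rewrite !expr2.
have dn := is_deriveD (is_deriveM f1 f1) (is_deriveM f2 f2).
have nt0 : n t != 0 by rewrite nE.
have dnV := is_deriveV nt0 dn.
split.
  rewrite (_ : (fun x => _) = (fun x => complex.Re (f x)) * (fun x => (n x)^-1));
    last by apply/funext => x; rewrite ReV -nE.
  apply: (is_derive_eq (is_deriveM f1 dnV)).
  rewrite nE expr2 !Re_mulc !Im_mulc !ReV !ImV /GRing.scale.
  case: df {f1 f2 dn dnV} => u v /=; case: (f t) n0 => x y /= n0.
  by field.
rewrite (_ : (fun x => _) = - ((fun x => complex.Im (f x)) * (fun x => (n x)^-1)));
  last by apply/funext => x; rewrite ImV -nE.
apply: (is_derive_eq (is_deriveN (is_deriveM f2 dnV))).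
rewrite nE expr2 !Im_mulc ?Re_mulc ?Im_mulc !ReV !ImV /GRing.scale.
case: df {f1 f2 dn dnV} => u v /=; case: (f t) n0 => x y /= n0.
by field.
Qed.

Lemma cderive_eq f t d d' : cderive f t d -> d = d' -> cderive f t d'.
Proof. by move=> ? <-. Qed.

Lemma cderiveN f t d : cderive f t d -> cderive (fun x => - f x) t (- d).
Proof.
move=> fd.
rewrite (_ : (fun x => _) = (fun x => (fun=> -1 : R[i]) x * f x));
  last by apply/funext => x; rewrite mulN1r.
apply: cderive_eq; first exact: cderiveM (cderive_cst _ _) fd.
by rewrite /= mul0r add0r mulN1r.
Qed.

Lemma cderive_line_re (w c : R) : cderive (fun x => Complex x w) c 1.
Proof. by split => /=; [exact: is_derive_id | exact: is_derive_cst]. Qed.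

Lemma cderive_line_im (c w : R) : cderive (fun x => Complex c x) w 'i%C.
Proof. by split => /=; [exact: is_derive_cst | exact: is_derive_id]. Qed.

Lemma cderive_continuous_Re f t d : cderive f t d ->
  {for t, continuous (fun x => complex.Re (f x))}.
Proof. by move=> [f1 _]; apply/differentiable_continuous/derivable1_diffP. Qed.

(* e^(-a (c + i w)) *)
Definition cexpN (a c w : R) : R[i] :=
  Complex (expR (- (a * c)) * cos (a * w)) (- (expR (- (a * c)) * sin (a * w))).

Lemma cderive_cexpN_re (a w c : R) :
  cderive (fun x => cexpN a x w) c (- a%:C%C * cexpN a c w * 1).
Proof.
have d1 : is_derive c 1 (fun x => expR (- (a * x))) (- a * expR (- (a * c))).
  have -> : (fun x => expR (- (a * x))) = expR \o (fun x => - (a * x)) by [].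
  apply: is_derive_eq; rewrite /GRing.scale/=; ring.
split => /=.
  by apply: is_derive_eq; rewrite /GRing.scale/=; ring.
by apply: is_derive_eq; rewrite /GRing.scale/=; ring.
Qed.

Lemma cderive_cexpN_im (a c w : R) :
  cderive (fun x => cexpN a c x) w (- a%:C%C * cexpN a c w * 'i%C).
Proof.
have d1 : is_derive w 1 (fun x => cos (a * x)) (- a * sin (a * w)).
  have -> : (fun x => cos (a * x)) = cos \o (fun x => a * x) by [].
  apply: is_derive_eq; rewrite /GRing.scale/=; ring.
have d2 : is_derive w 1 (fun x => sin (a * x)) (a * cos (a * w)).
  have -> : (fun x => sin (a * x)) = sin \o (fun x => a * x) by [].
  apply: is_derive_eq; rewrite /GRing.scale/=; ring.
split => /=.
  by apply: is_derive_eq; rewrite /GRing.scale/=; ring.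
by apply: is_derive_eq; rewrite /GRing.scale/=; ring.
Qed.

End ComplexCurves.

(** * The function F and its derivative along a curve *)

Section Kernel.
Variables (R : realType) (a q : R).
Local Notation aC := (a%:C%C).
Local Notation qC := (q%:C%C).

(* [kerF q z e] is F z when e = e^(-az); the primed functions are the derivatives
   in z, with e' = - a e. *)
Definition kerP (z e : R[i]) : R[i] :=
  2 * (e * (e + z)^-1) - 1 + qC * (1 - 2 * (1 + z)^-1).

Definition kerP' (z e : R[i]) : R[i] :=
  - 2 * (aC * e * (e + z)^-1 + e * (1 - aC * e) * (e + z)^-1 ^+ 2)
  + 2 * qC * (1 + z)^-1 ^+ 2.

Definition kerF (z e : R[i]) : R[i] := kerP z e * (1 + z * z)^-1.

Definition kerF' (z e : R[i]) : R[i] :=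
  kerP' z e * (1 + z * z)^-1 - 2 * kerP z e * z * (1 + z * z)^-1 ^+ 2.

Section curve.
Variables (S E : R -> R[i]) (t : R) (d : R[i]).
Hypotheses (dS : cderive S t d) (dE : cderive E t (- aC * E t * d)).
Hypotheses (h0 : E t + S t != 0) (k0 : 1 + S t != 0) (r0 : 1 + S t * S t != 0).

Let dh := cderiveV h0 (cderiveD dE dS).
Let dk := cderiveV k0 (cderiveD (cderive_cst 1 t) dS).
Let dr := cderiveV r0 (cderiveD (cderive_cst 1 t) (cderiveM dS dS)).

Let dP : cderive (fun x => kerP (S x) (E x)) t (kerP' (S t) (E t) * d).
Proof.
apply: cderive_eq.
  apply: cderiveD; last apply: cderiveM; first apply: cderiveD.
  - apply: cderiveM; first exact: cderive_cst.
    exact: cderiveM dE dh.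
  - exact: cderive_cst.
  - exact: cderive_cst.
  - apply: cderiveD; first exact: cderive_cst.
    apply: cderiveN.
    apply: cderiveM; first exact: cderive_cst.
    exact: dk.
rewrite /kerP' /=.
move: (E t + S t)^-1 (1 + S t)^-1 (E t) => x y u; ring.
Qed.

(** The hypothesis on [E] is the equation that e = e^(-az) satisfies along the curve z = [S]. The
    factor in front of [d] does not depend on the direction of the curve: this is holomorphy of
    F. *)
Lemma cderive_kerF : cderive (fun x => kerF (S x) (E x)) t (kerF' (S t) (E t) * d).
Proof.
apply: cderive_eq; first exact: cderiveM dP dr.
rewrite /kerF' /=.
move: (1 + S t * S t)^-1 (kerP' _ _) (kerP _ _) => x y u; ring.
Qed.

(** Existence is enough: it gives the continuity of Re F' on vertical lines. *)
Lemma cderive_kerF' : exists d', cderive (fun x => kerF' (S x) (E x)) t d'.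
Proof.
have dh2 := cderiveM dh dh; have dk2 := cderiveM dk dk; have dr2 := cderiveM dr dr.
eexists; rewrite /kerF' /kerP'.
apply: cderiveD; last apply: cderiveN.
  apply: cderiveM; last exact: dr.
  apply: cderiveD.
    apply: cderiveM; first exact: cderive_cst.
    apply: cderiveD.
      apply: cderiveM dh.
      by apply: cderiveM dE; exact: cderive_cst.
    apply: cderiveM dh2.
    apply: cderiveM; first exact: dE.
    apply: cderiveD; first exact: cderive_cst.
    apply: cderiveN.
    by apply: cderiveM dE; exact: cderive_cst.
  by apply: cderiveM dk2; exact: cderive_cst.
apply: cderiveM dr2.
apply: cderiveM dS.
by apply: cderiveM dP; exact: cderive_cst.
Qed.

End curve.

End Kernel.

(** * The complex modulus as a real number *)

Section NormC.
Variable R : realType.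
Implicit Types x y z : R[i].

Lemma normc_ge0 z : 0 <= normc z.
Proof. by case: z => x y; exact: sqrtr_ge0. Qed.

Lemma ler_normcD x y : normc (x + y) <= normc x + normc y.
Proof. exact: le_normcD. Qed.

Lemma normc_opp x : normc (- x) = normc x.
Proof. exact: normcN. Qed.

Lemma ler_normcB x y : normc (x - y) <= normc x + normc y.
Proof. by rewrite -(normc_opp y) ler_normcD. Qed.

Lemma normc_real (r : R) : normc r%:C%C = `|r|.
Proof. by rewrite /= expr0n addr0 sqrtr_sqr. Qed.

Lemma normc_sqr z : normc z ^+ 2 = complex.Re z ^+ 2 + complex.Im z ^+ 2.
Proof. by case: z => x y /=; rewrite sqr_sqrtr// addr_ge0// sqr_ge0. Qed.

Lemma ler_Re_normc z : `|complex.Re z| <= normc z.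
Proof.
rewrite -(ler_pXn2r (n := 2))// ?nnegrE ?normc_ge0// normc_sqr.
by rewrite real_normK ?num_real// lerDl sqr_ge0.
Qed.

Lemma ler_Im_normc z : `|complex.Im z| <= normc z.
Proof.
rewrite -(ler_pXn2r (n := 2))// ?nnegrE ?normc_ge0// normc_sqr.
by rewrite real_normK ?num_real// lerDr sqr_ge0.
Qed.

Lemma normc_gt0 z : (0 < normc z) = (z != 0).
Proof.
rewrite lt_neqAle normc_ge0 andbT eq_sym; congr negb.
by apply/eqP/eqP => [/Normc.eq0_normc//|->]; rewrite Normc.normc0.
Qed.

Lemma normc_nat n : normc n%:R = n%:R :> R.
Proof. by rewrite -[in LHS](rmorph_nat (real_complex R)) normc_real normr_nat. Qed.

End NormC.

(** * Trigonometric estimates and the characteristic function e^(-az) + z *)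

Section Trig.
Variable R : realType.
Implicit Types x y a : R.

Lemma ler_norm_sin x : `|sin x| <= `|x|.
Proof.
wlog x0 : x / 0 <= x => [H|].
  have [|/ltW x0] := leP 0 x; first exact: H.
  by rewrite -normrN -sinN -(normrN x) H// oppr_ge0.
have [|c _] := @MVT_segment _ (@sin R) cos 0 x x0 (fun c _ => is_derive_sin c).
  by apply: continuous_subspaceT => c; exact: continuous_sin.
by rewrite sin0 !subr0 => ->; rewrite normrM ler_piMl// cos_max.
Qed.

Lemma onem_cos_le x : 1 - cos x <= x ^+ 2 / 2.
Proof.
have x2 : (x / 2) *+ 2 = x by rewrite mulr2n -splitr.
rewrite -{1}x2.
rewrite cos_mulr2n cos2sin2 mulr2n.
have : sin (x / 2) ^+ 2 <= (x / 2) ^+ 2.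
  by rewrite -[leRHS]real_normK ?num_real// -[leLHS]real_normK ?num_real//
    lerXn2r ?nnegrE// ler_norm_sin.
lra.
Qed.

Lemma normc_cexpN a c w : normc (cexpN a c w) = expR (- (a * c)).
Proof.
rewrite /= sqrrN !exprMn -mulrDr cos2Dsin2 mulr1 sqrtr_sqr.
by rewrite ger0_norm ?expR_ge0.
Qed.

Lemma normc_cexpN_le1 a c w : 0 <= a -> 0 <= c -> normc (cexpN a c w) <= 1.
Proof. by move=> a0 c0; rewrite normc_cexpN -expR0 ler_expR oppr_le0 mulr_ge0. Qed.

(** For points of moduli E = e^(-ac) and 1 the squared distance is (1 - E)^2 + 2 E (1 - cos (a (w -
    v))). Since 1 - E <= a c, E <= 1 and 1 - cos x <= x^2 / 2, it is at most a^2 (c^2 + (w -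
    v)^2). *)
Lemma cexpN_lipschitz a c w v : 0 <= a -> 0 <= c ->
  normc (cexpN a c w - cexpN a 0 v) <= a * normc (Complex c w - Complex 0 v).
Proof.
move=> a0 c0; rewrite -(ler_pXn2r (n := 2))// ?nnegrE ?mulr_ge0 ?normc_ge0//.
rewrite exprMn !normc_sqr /= mulr0 oppr0 expR0 !mul1r ?subr0 ?addr0 ?opprK.
set E := expR _.
have E0 : 0 < E by exact: expR_gt0.
have E1 : E <= 1 by rewrite -expR0 ler_expR oppr_le0 mulr_ge0.
have Eac : 1 - E <= a * c.
  have := expR_ge1Dx (- (a * c)); rewrite -/E; lra.
have : 1 - cos (a * w - a * v) <= (a * (w - v)) ^+ 2 / 2.
  by rewrite -mulrBr onem_cos_le.
rewrite cosB.
have := cos2Dsin2 (a * w); have := cos2Dsin2 (a * v).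
move: (cos _) (sin _) (cos (a * w)) (sin (a * w)) => C1 S1 C2 S2 h1 h2 h3.
have -> : (E * C2 - C1) ^+ 2 + (- (E * S2) + S1) ^+ 2 =
    (1 - E) ^+ 2 + 2 * E * (1 - (C2 * C1 + S2 * S1)).
  have -> : (E * C2 - C1) ^+ 2 + (- (E * S2) + S1) ^+ 2 =
    E ^+ 2 * (C2 ^+ 2 + S2 ^+ 2) + (C1 ^+ 2 + S1 ^+ 2) - 2 * E * (C2 * C1 + S2 * S1) by ring.
  by rewrite h1 h2; ring.
rewrite [leRHS]mulrDr -!exprMn; apply: lerD.
  by rewrite ler_pXn2r ?nnegrE ?subr_ge0// mulr_ge0.
apply: (@le_trans _ _ (E * (a * (w - v)) ^+ 2)).
  by rewrite (mulrC 2 E) -mulrA ler_pM2l// mulrC -ler_pdivlMr.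
by rewrite ler_piMl ?sqr_ge0.
Qed.

(** For |w| >= 1 + eps the imaginary part is at least |w| - 1 >= eps in absolute value. Otherwise a
    |w| < pi / 2, so cos (a w) >= k > 0 and the real part is at least c + k e^(-ac), which exceeds 1
    or k e^(-a) according to whether c >= 1 or c < 1. *)
Lemma characteristic_lower_bound a : 0 <= a -> a < pi / 2 ->
  exists2 d, 0 < d & forall c w, 0 <= c -> d <= normc (cexpN a c w + Complex c w).
Proof.
move=> a0 api.
(* Small enough that a (1 + eps) < pi / 2; the summand 1 in the denominator covers a = 0. *)
pose eps := (pi / 2 - a) / (2 * (a + 1)).
have e0 : 0 < eps by rewrite divr_gt0// ?subr_gt0// mulr_gt0// ltr_wpDl.
have ae : a * (1 + eps) < pi / 2.
  rewrite mulrDr mulr1 -ltrBrDl /eps mulrCA gtr_pMr ?subr_gt0//.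
  by rewrite ltr_pdivrMr ?mulr_gt0 ?ltr_wpDl// mul1r; lra.
pose k := cos (a * (1 + eps)).
have ae0 : 0 <= a * (1 + eps) by rewrite mulr_ge0// addr_ge0// ltW.
have pi0 := pi_gt0 R.
have k0 : 0 < k by apply: cos_gt0_pihalf; apply/andP; split => //; lra.
exists (Num.min eps (Num.min 1 (k * expR (- a)))).
  by rewrite !lt_min e0 ltr01 mulr_gt0 ?expR_gt0.
move=> c w c0; rewrite !ge_min.
have E1 : expR (- (a * c)) <= 1 by rewrite -expR0 ler_expR oppr_le0 mulr_ge0.
have E0 : 0 < expR (- (a * c)) by exact: expR_gt0.
have [we|we] := leP (1 + eps) `|w|.
  apply/orP; left; apply: le_trans (ler_Im_normc _); rewrite /= addrC.
  apply: le_trans (lerB_dist _ _); rewrite lerBrDr.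
  apply: le_trans we; rewrite addrC lerD2r normrM gtr0_norm//.
  by rewrite -[leRHS]mulr1 ler_pM// ?sin_max// ltW.
apply/orP; right.
have kcos : k <= cos (a * w).
  rewrite -cos_norm normrM (ger0_norm a0) leNgt ltr_cos ?in_itv/=.
  - by rewrite -leNgt ler_wpM2l// ltW.
  - by rewrite ae0/=; lra.
  - rewrite mulr_ge0//=.
    have : a * `|w| <= a * (1 + eps) by rewrite ler_wpM2l// ltW.
    lra.
have Re_ge : c + k * expR (- (a * c)) <= normc (cexpN a c w + Complex c w).
  apply: le_trans (ler_Re_normc _); apply: le_trans (ler_norm _) => /=.
  by rewrite addrC lerD2r mulrC ler_pM2l.
have [c1|c1] := leP 1 c.
  apply/orP; left; apply: le_trans Re_ge; apply: (le_trans c1).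
  by rewrite lerDl mulr_ge0// ltW.
apply/orP; right; apply: le_trans Re_ge.
apply: (@le_trans _ _ (k * expR (- (a * c)))); last by rewrite lerDr.
by rewrite ler_pM2l// ler_expR lerN2 -[leRHS]mulr1 ler_wpM2l// ltW.
Qed.

End Trig.

(** * Bounds for F and F' on the right half-plane *)

Section KernelBounds.
Variables (R : realType) (a : R).
Hypotheses (a0 : 0 <= a) (api : a < pi / 2).
Implicit Types (c w v : R) (z e : R[i]).

Definition delayQ : R := cos a / (1 - sin a).
Local Notation q := delayQ.
Local Notation E := (cexpN a).

Lemma cosa_gt0 : 0 < cos a.
Proof.
apply: cos_gt0_pihalf; rewrite api andbT (lt_le_trans _ a0)//.
by rewrite oppr_lt0 divr_gt0// pi_gt0.
Qed.

Lemma sina_lt1 : 0 < 1 - sin a.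
Proof.
rewrite subr_gt0 lt_neqAle sin_le1 andbT; apply/eqP => s1.
have := cos2Dsin2 a; rewrite s1 expr1n => /eqP.
by rewrite -subr_eq0 addrK sqrf_eq0 gt_eqF// cosa_gt0.
Qed.

Lemma delayQ_gt0 : 0 < q.
Proof. by rewrite divr_gt0// ?cosa_gt0 ?sina_lt1. Qed.

Lemma characteristic_neq0 c w : 0 <= c -> E c w + Complex c w != 0.
Proof.
move=> c0; have [d d0 /(_ c w c0)] := characteristic_lower_bound a0 api.
by rewrite -normc_gt0; exact: lt_le_trans.
Qed.

Lemma normc_oneD_ge1 c w : 0 <= c -> 1 <= normc (1 + Complex c w).
Proof.
move=> c0; apply: le_trans (ler_Re_normc _); apply: le_trans (ler_norm _) => /=.
by rewrite lerDl.
Qed.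

Lemma oneD_neq0 c w : 0 <= c -> 1 + Complex c w != 0.
Proof. by move=> c0; rewrite -normc_gt0 (lt_le_trans _ (normc_oneD_ge1 w c0)). Qed.

Lemma oneDsqr_factor z : 1 + z * z = (z - 'i%C) * (z + 'i%C).
Proof. by case: z => x y; apply/eqP; rewrite eq_complex /=; apply/andP; split; apply/eqP; ring. Qed.

(** [kerP] splits constants off the quotients, which suits derivatives and differences; the quotient
    form here is the one to evaluate at z = i, z = -i and on the imaginary axis. *)
Lemma kerP_frac z e : e + z != 0 -> 1 + z != 0 ->
  kerP q z e = (e - z) * (e + z)^-1 + q%:C%C * ((z - 1) * (1 + z)^-1).
Proof. by move=> h0 k0; rewrite /kerP; field; rewrite ?h0 ?k0 ?(addrC z) ?h0 ?k0. Qed.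

(** From q (1 - sin a) = cos a and q cos a = 1 + sin a one gets e - z = - q z (e + z) at z = iv,
    while z^2 = -1 gives z - 1 = z (1 + z). The two terms of [kerP] are then - q z and q z. *)
Lemma kerP_pole v : v ^+ 2 = 1 -> kerP q (Complex 0 v) (E 0 v) = 0.
Proof.
move=> v1; have h0 := characteristic_neq0 v (lexx 0); have k0 := oneD_neq0 v (lexx 0).
have [sv cv] : sin (a * v) = v * sin a /\ cos (a * v) = cos a.
  move/eqP: v1; rewrite sqrf_eq1 => /orP[] /eqP ->; first by rewrite mulr1 mul1r.
  by rewrite mulrN1 sinN cosN mulN1r.
have s1 := sina_lt1; have := cos2Dsin2 a => cs.
have q1 : q * (1 - sin a) = cos a by rewrite divfK// gt_eqF.
have q2 : q * cos a = 1 + sin a.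
  apply: (mulIf (lt0r_neq0 s1)); rewrite mulrAC q1.
  by rewrite -expr2 mulrC -subr_sqr expr1n -cs addrK.
rewrite kerP_frac//.
have -> : E 0 v - Complex 0 v = - q%:C%C * Complex 0 v * (E 0 v + Complex 0 v).
  rewrite /cexpN sv cv mulr0 oppr0 expR0 !mul1r.
  apply/eqP; rewrite eq_complex /=; apply/andP; split; apply/eqP.
    rewrite -q1; have : q * (1 - sin a) = q * (1 - sin a) * v ^+ 2 by rewrite v1 mulr1.
    lra.
  have : v * (q * cos a) = v * (1 + sin a) by rewrite q2.
  lra.
have -> : Complex 0 v - 1 = Complex 0 v * (1 + Complex 0 v).
  apply/eqP; rewrite eq_complex /=; apply/andP; split; apply/eqP; last by ring.
  by rewrite -v1; ring.
by rewrite !mulfK//; ring.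
Qed.

(** Distance to the poles i and -i, cut off at 1: a bound linear in it expresses boundedness and
    vanishing at both poles at once. *)
Definition pole_dist z := Num.min 1 (Num.min (normc (z - 'i%C)) (normc (z + 'i%C))).

(** Subtract the value 0 at the pole iv and put the differences over common denominators. These are
    at least d^2 and 1 in modulus, and the numerators are controlled by [cexpN_lipschitz]. *)
Lemma kerP_lipschitz : exists2 M, 0 < M & forall c w v, 0 <= c -> v ^+ 2 = 1 ->
  normc (kerP q (Complex c w) (E c w)) <= M * normc (Complex c w - Complex 0 v).
Proof.
have [d d0 dle] := characteristic_lower_bound a0 api.
have q0 := delayQ_gt0.
exists (2 * (a + 1) * d^-1 ^+ 2 + 2 * q).
  apply: ltr_wpDl; last by rewrite mulr_gt0.
  by rewrite !mulr_ge0 ?invr_ge0 ?(ltW d0) ?sqr_ge0 ?addr_ge0.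
move=> c w v c0 v1; rewrite -[kerP _ _ _]subr0 -(kerP_pole v1).
have h0 := characteristic_neq0 w c0; have h0' := characteristic_neq0 v (lexx 0).
have k0 := oneD_neq0 w c0; have k0' := oneD_neq0 v (lexx 0).
have H1 := dle c w c0; have H2 := dle 0 v (lexx 0).
have K1 := normc_oneD_ge1 w c0; have K2 := normc_oneD_ge1 v (lexx 0).
have nv : normc (Complex 0 v) = 1 by rewrite /= expr0n add0r v1 sqrtr1.
have lip := cexpN_lipschitz w v a0 c0.
have e1 := normc_cexpN_le1 v a0 (lexx 0).
move: (Complex c w) (Complex 0 v) (E c w) (E 0 v) => z z0 e e0
  in h0 h0' k0 k0' H1 H2 K1 K2 nv lip e1 *.
(* The numerator e z0 - e0 z is written through the increments e - e0 and z - z0. *)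
have -> : kerP q z e - kerP q z0 e0 =
    2 * ((e - e0) * z0 - e0 * (z - z0)) * ((e + z)^-1 * (e0 + z0)^-1)
    + 2 * q%:C%C * (z - z0) * ((1 + z)^-1 * (1 + z0)^-1).
  by rewrite /kerP; field; rewrite h0 h0' k0 k0'.
rewrite [leRHS]mulrDl; apply: (le_trans (ler_normcD _ _)); apply: lerD.
  rewrite !Normc.normcM !Normc.normcV normc_nat.
  have -> : 2 * (a + 1) * d^-1 ^+ 2 * normc (z - z0) =
    2 * ((a + 1) * normc (z - z0)) * (d^-1 * d^-1) by rewrite expr2; ring.
  apply: ler_pM; rewrite ?mulr_ge0 ?invr_ge0 ?normc_ge0//.
    rewrite ler_pM2l//.
    apply: (le_trans (ler_normcB _ _)); rewrite !Normc.normcM nv mulr1 mulrDl mul1r.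
    by apply: lerD => //; rewrite ler_piMl ?normc_ge0.
  by apply: ler_pM; rewrite ?invr_ge0 ?normc_ge0// lef_pV2 ?posrE// (lt_le_trans d0).
rewrite !Normc.normcM !Normc.normcV normc_nat normc_real (ger0_norm (ltW q0)).
apply: ler_piMr; first exact: (mulr_ge0 (mulr_ge0 (ler0n _ 2) (ltW q0)) (normc_ge0 _)).
by rewrite mulr_ile1 ?invr_ge0 ?normc_ge0// invf_le1// (lt_le_trans ltr01).
Qed.

(** The three arguments of the minimum in [pole_dist] give three inequalities: a crude bound by 2 /
    d + 1 + 3 q, and the Lipschitz bound at v = 1 and at v = -1. *)
Lemma normc_kerP_le : exists2 M, 0 < M & forall c w, 0 <= c ->
  normc (kerP q (Complex c w) (E c w)) <= M * pole_dist (Complex c w).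
Proof.
have [d d0 dle] := characteristic_lower_bound a0 api.
have [M M0 Mle] := kerP_lipschitz.
have q0 := delayQ_gt0.
exists (Num.max M (2 / d + 1 + 3 * q)); first by rewrite lt_max M0.
have Mp : 0 < Num.max M (2 / d + 1 + 3 * q) by rewrite lt_max M0.
move=> c w c0; rewrite /pole_dist !minr_pMr ?(ltW Mp)// !le_min; apply/and3P; split.
- rewrite mulr1 le_max; apply/orP; right.
  have H1 := dle c w c0; have K1 := normc_oneD_ge1 w c0.
  have e1 := normc_cexpN_le1 w a0 c0.
  rewrite /kerP; apply: (le_trans (ler_normcD _ _)); apply: lerD.
    apply: (le_trans (ler_normcB _ _)); rewrite Normc.normc1 lerD2r.
    rewrite !Normc.normcM Normc.normcV normc_nat ler_pM2l// -[leRHS]mul1r.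
    by apply: ler_pM; rewrite ?invr_ge0 ?normc_ge0// lef_pV2 ?posrE// (lt_le_trans d0).
  rewrite Normc.normcM normc_real (ger0_norm (ltW q0)) mulrC ler_pM2r//.
  apply: (le_trans (ler_normcB _ _)); rewrite Normc.normc1.
  have : (normc (1 + Complex c w))^-1 <= 1 by rewrite invf_le1// (lt_le_trans ltr01).
  rewrite !Normc.normcM Normc.normcV normc_nat; lra.
- apply: (le_trans (Mle c w 1 c0 _)); first by rewrite expr1n.
  by rewrite ler_wpM2r ?normc_ge0// le_max lexx.
- apply: (le_trans (Mle c w (-1) c0 _)); first by rewrite sqrrN expr1n.
  have -> : Complex c w - Complex 0 (-1) = Complex c w + 'i%C.
    by apply/eqP; rewrite eq_complex /= oppr0 opprK !eqxx.
  by rewrite ler_wpM2r ?normc_ge0// le_max lexx.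
Qed.

Lemma normc_kerP'_le : exists2 M, 0 < M & forall c w, 0 <= c ->
  normc (kerP' a q (Complex c w) (E c w)) <= M.
Proof.
have [d d0 dle] := characteristic_lower_bound a0 api.
have q0 := delayQ_gt0.
exists (2 * (a * d^-1 + (1 + a) * d^-1 ^+ 2) + 2 * q).
  apply: ltr_wpDl; last by rewrite mulr_gt0.
  by rewrite mulr_ge0// addr_ge0// mulr_ge0 ?invr_ge0 ?sqr_ge0 ?addr_ge0 ?(ltW d0).
move=> c w c0.
have e1 := normc_cexpN_le1 w a0 c0.
have H1 : (normc (E c w + Complex c w))^-1 <= d^-1.
  by have H1 := dle c w c0; rewrite lef_pV2 ?posrE// (lt_le_trans d0).
have K1 : (normc (1 + Complex c w))^-1 <= 1.
  by have K1 := normc_oneD_ge1 w c0; rewrite invf_le1// (lt_le_trans ltr01).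
have ea : normc (a%:C%C * E c w) <= a.
  by rewrite Normc.normcM normc_real (ger0_norm a0) ler_piMr.
have iv (x : R[i]) : 0 <= (normc x)^-1 by rewrite invr_ge0 normc_ge0.
have sq (x : R[i]) : normc (x ^+ 2) = normc x ^+ 2 by rewrite !expr2 Normc.normcM.
rewrite /kerP'; apply: (le_trans (ler_normcD _ _)); apply: lerD.
  rewrite mulNr normc_opp Normc.normcM normc_nat ler_pM2l//.
  apply: (le_trans (ler_normcD _ _)); apply: lerD.
    by rewrite Normc.normcM Normc.normcV ler_pM ?normc_ge0.
  rewrite Normc.normcM sq Normc.normcV; apply: ler_pM; rewrite ?normc_ge0 ?exprn_ge0//.
    rewrite Normc.normcM -[leRHS]mul1r ler_pM ?normc_ge0//.
    by apply: (le_trans (ler_normcB _ _)); rewrite Normc.normc1 lerD2l.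
  by rewrite lerXn2r ?nnegrE ?invr_ge0 ?normc_ge0 ?(ltW d0).
rewrite Normc.normcM sq Normc.normcV (Normc.normcM 2) normc_nat normc_real (ger0_norm (ltW q0)).
by apply: ler_piMr; [exact: (mulr_ge0 (ler0n _ 2) (ltW q0)) | rewrite exprn_ile1].
Qed.

Lemma pole_dist_ge0 z : 0 <= pole_dist z.
Proof. by rewrite /pole_dist !le_min ler01 !normc_ge0. Qed.

(** Factor 1 + z^2 = (z - i) (z + i) and let u = |w|. For u <= 2 one has 1 + u^2 <= 5, one factor is
    at least [pole_dist] and the other at least u + 1 >= 1; for u > 2 the factors are at least u - 1
    and u + 1, and 1 + u^2 <= 5 (u^2 - 1). The sign of w only exchanges the factors. *)
Lemma pole_dist_oneDsqr c w :
  (1 + w ^+ 2) * pole_dist (Complex c w) <= 5 * normc (1 + Complex c w * Complex c w).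
Proof.
rewrite oneDsqr_factor Normc.normcM mulrA.
have : pole_dist (Complex c w) <= 1 by rewrite /pole_dist ge_min lexx.
have : pole_dist (Complex c w) <= normc (Complex c w - 'i%C).
  by rewrite /pole_dist !ge_min lexx orbT.
have : pole_dist (Complex c w) <= normc (Complex c w + 'i%C).
  by rewrite /pole_dist !ge_min lexx !orbT.
have := ler_Im_normc (Complex c w - 'i%C); have := ler_Im_normc (Complex c w + 'i%C).
have := pole_dist_ge0 (Complex c w).
rewrite [complex.Im _]/= [complex.Im (_ - _)]/=.
move: (pole_dist _) (normc _) (normc _) => m n2 n1 m0 n2w n1w mn2 mn1 m1.
have key u (x y : R) : 0 <= u -> m <= x -> `|u - 1| <= x -> `|u + 1| <= y ->
    (1 + u ^+ 2) * m <= 5 * x * y.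
  move=> u0 mx ux uy.
  have y1 : u + 1 <= y by apply: le_trans uy; rewrite ler_norm.
  have x1 : u - 1 <= x by apply: le_trans ux; rewrite ler_norm.
  have [u2|u2] := leP u 2.
    apply: (@le_trans _ _ (5 * x)); first by apply: ler_pM => //; nra.
    by rewrite ler_peMr//; lra.
  apply: (@le_trans _ _ (5 * (u - 1) * (u + 1))); first by nra.
  by rewrite ler_pM//; lra.
have [w0|w0] := leP 0 w; first exact: key.
rewrite mulrAC -sqrrN; apply: key => //; first by lra.
  by rewrite -normrN opprD !opprK.
by rewrite -normrN opprD !opprK.
Qed.

Lemma oneDsqr_neq0 c w : 0 < c -> 1 + Complex c w * Complex c w != 0.
Proof.
move=> c0; rewrite oneDsqr_factor mulf_neq0// eq_complex /= ?oppr0 ?subr0 ?addr0 (gt_eqF c0)//.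
Qed.

Lemma oneDw_gt0 w : 0 < 1 + w ^+ 2.
Proof. by rewrite ltr_pwDl// sqr_ge0. Qed.

(** The zeros of the numerator cancel the poles of 1 / (1 + z^2). The bound is uniform down to the
    imaginary axis and serves as the integrable majorant on every vertical line. *)
Lemma normc_kerF_le : exists2 M, 0 < M & forall c w, 0 < c ->
  normc (kerF q (Complex c w) (E c w)) <= M * (1 + w ^+ 2)^-1.
Proof.
have [M M0 Mle] := normc_kerP_le.
exists (5 * M) => [|c w c0]; first by rewrite mulr_gt0.
rewrite /kerF Normc.normcM Normc.normcV.
have n0 : 0 < normc (1 + Complex c w * Complex c w) by rewrite normc_gt0 oneDsqr_neq0.
rewrite ler_pdivrMr// mulrAC ler_pdivlMr ?oneDw_gt0//.
apply: (@le_trans _ _ (M * ((1 + w ^+ 2) * pole_dist (Complex c w)))).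
  by rewrite mulrCA mulrC ler_pM2l ?oneDw_gt0// Mle// ltW.
by rewrite (mulrC 5) -mulrA ler_pM2l// pole_dist_oneDsqr.
Qed.

(** Both |z - i| and |z + i| are at least Re z. This gives the pointwise decay as c grows. *)
Lemma normc_kerF_le_sqr : exists2 M, 0 < M & forall c w, 0 < c ->
  normc (kerF q (Complex c w) (E c w)) <= M * c^-1 ^+ 2.
Proof.
have [M M0 Mle] := normc_kerP_le.
exists M => // c w c0; rewrite /kerF Normc.normcM Normc.normcV.
apply: ler_pM; rewrite ?invr_ge0 ?normc_ge0//.
  apply: (le_trans (Mle c w (ltW c0))).
  by rewrite ler_piMr ?(ltW M0)// /pole_dist ge_min lexx.
rewrite oneDsqr_factor Normc.normcM invfM expr2.
have c_le z : complex.Re z = 0 -> (normc (Complex c w + z))^-1 <= c^-1.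
  move=> z0; have cz : c <= normc (Complex c w + z).
    apply: le_trans (ler_Re_normc _); apply: le_trans (ler_norm _).
    by rewrite Re_addc z0 addr0.
  by rewrite lef_pV2 ?posrE// (lt_le_trans c0).
by apply: ler_pM; rewrite ?invr_ge0 ?normc_ge0// c_le//= oppr0.
Qed.

(** The constant may depend on [c1], because differentiation under the integral sign is local in c.
    To the right of [c1] the quantity [pole_dist] is at least [m], so 1 / (1 + z^2) is itself
    bounded by a multiple of 1 / (1 + w^2). *)
Lemma normc_kerF'_le c1 : 0 < c1 -> exists2 M, 0 < M & forall c w, c1 < c ->
  normc (kerF' a q (Complex c w) (E c w)) <= M * (1 + w ^+ 2)^-1.
Proof.
move=> c10; have [M M0 Mle] := normc_kerF_le.
have [M' M'0 M'le] := normc_kerP'_le.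
pose m := Num.min 1 c1.
have m0 : 0 < m by rewrite lt_min ltr01.
exists (5 * M' / m + 2 * M / c1) => [|c w c1c].
  by rewrite addr_gt0// divr_gt0// mulr_gt0.
have c0 : 0 < c by exact: lt_trans c1c.
have W0 := oneDw_gt0 w.
have n0 : 0 < normc (1 + Complex c w * Complex c w) by rewrite normc_gt0 oneDsqr_neq0.
have rle : (normc (1 + Complex c w * Complex c w))^-1 <= 5 / m * (1 + w ^+ 2)^-1.
  rewrite -[leLHS]mul1r ler_pdivrMr// mulrAC ler_pdivlMr// mul1r mulrAC ler_pdivlMr//.
  apply: le_trans (pole_dist_oneDsqr c w); rewrite ler_pM2l//.
  have cle z : complex.Re z = 0 -> c <= normc (Complex c w + z).
    move=> z0; apply: le_trans (ler_Re_normc _); apply: le_trans (ler_norm _).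
    by rewrite Re_addc z0 addr0.
  rewrite /m /pole_dist !le_min !ge_min lexx orTb andTb; apply/andP; split; apply/orP; right;
    by apply: (le_trans (ltW c1c)); rewrite cle//= oppr0.
have zr : normc (Complex c w * (1 + Complex c w * Complex c w)^-1) <= c1^-1.
  (* Partial fractions absorb the factor z in the numerator. *)
  have -> : Complex c w * (1 + Complex c w * Complex c w)^-1 =
      2^-1 * ((Complex c w + 'i%C)^-1 + (Complex c w - 'i%C)^-1).
    have := oneDsqr_neq0 w c0; rewrite oneDsqr_factor mulf_eq0 negb_or => /andP[p1 p2].
    by field; rewrite p1 p2.
  have cle z : complex.Re z = 0 -> (normc (Complex c w + z)^-1) <= c1^-1.
    move=> z0; have cz : c1 <= normc (Complex c w + z).
      apply: (le_trans (ltW c1c)).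
      apply: le_trans (ler_Re_normc _); apply: le_trans (ler_norm _).
      by rewrite Re_addc z0 addr0.
    by rewrite Normc.normcV lef_pV2 ?posrE// (lt_le_trans c10).
  rewrite Normc.normcM Normc.normcV normc_nat ler_pdivrMl//.
  apply: (le_trans (ler_normcD _ _)).
  have := cle 'i%C erefl; have := cle (- 'i%C) (oppr0 _); lra.
rewrite /kerF' [leRHS]mulrDl; apply: (le_trans (ler_normcB _ _)); apply: lerD.
  rewrite Normc.normcM Normc.normcV.
  have -> : 5 * M' / m * (1 + w ^+ 2)^-1 = M' * (5 / m * (1 + w ^+ 2)^-1) by ring.
  by rewrite ler_pM ?invr_ge0 ?normc_ge0// M'le// ltW.
have -> : 2 * kerP q (Complex c w) (E c w) * Complex c w *
    (1 + Complex c w * Complex c w)^-1 ^+ 2 =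
    2 * (kerF q (Complex c w) (E c w) *
      (Complex c w * (1 + Complex c w * Complex c w)^-1)) by rewrite /kerF; ring.
have -> : 2 * M / c1 * (1 + w ^+ 2)^-1 = 2 * (M * (1 + w ^+ 2)^-1 * c1^-1) by ring.
by rewrite Normc.normcM normc_nat ler_pM2l// Normc.normcM ler_pM ?normc_ge0// Mle.
Qed.

End KernelBounds.

(** * Integrals dominated by the Cauchy density *)

Section CauchyDensity.
Variable R : realType.
Notation mu := (@lebesgue_measure R).

Lemma continuous_cauchy : continuous (fun x : R => (1 + x ^+ 2)^-1).
Proof. exact: continuous_oneDsqrV. Qed.

Lemma integral_cauchy : (\int[mu]_x ((1 + x ^+ 2)^-1)%:E = (pi : R)%:E)%E.
Proof.
rewrite ge0_symfun_integralT/=.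
- rewrite -set_itvcy integral0y_oneDsqr -EFinM; congr EFin.
  by field.
- by move=> x; rewrite invr_ge0 ltW// oneDw_gt0.
- exact: continuous_cauchy.
- by move=> x /=; rewrite sqrrN.
Qed.

Lemma integrable_cauchy : mu.-integrable setT (EFin \o (fun x : R => (1 + x ^+ 2)^-1)).
Proof.
apply/integrableP; split.
  apply/measurable_EFinP; apply: (@continuous_measurable_fun R); exact: continuous_cauchy.
under eq_integral do rewrite /= ger0_norm ?invr_ge0 ?(ltW (oneDw_gt0 _))//.
by rewrite integral_cauchy ltry.
Qed.

Lemma integrable_cauchyZ M : mu.-integrable setT (EFin \o (fun x : R => M * (1 + x ^+ 2)^-1)).
Proof.
exact: (integrableZl measurableT M integrable_cauchy).
Qed.

Lemma integrable_dominated (f : R -> R) M : continuous f ->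
  (forall x, `|f x| <= M * (1 + x ^+ 2)^-1) -> mu.-integrable setT (EFin \o f).
Proof.
move=> cf fM; apply: le_integrable (integrable_cauchyZ M) => //.
  by apply/measurable_EFinP; exact: continuous_measurable_fun.
by move=> x _ /=; rewrite lee_fin (le_trans (fM x))// ler_norm.
Qed.

Lemma cvg_cauchy0 M : (fun n => M * (1 + n%:R ^+ 2)^-1 : R) @ \oo --> (0 : R).
Proof.
rewrite -[X in _ --> X](mulr0 M); apply: cvgM; first exact: cvg_cst.
apply: (@squeeze_cvgr _ _ _ _ (fun=> 0) (@harmonic R)).
- near=> n; rewrite invr_ge0 ltW ?oneDw_gt0//= /harmonic lef_pV2 ?posrE ?oneDw_gt0//.
  rewrite -natr1 addrC lerD2l -natrX ler_nat.
  by have [->//|n0] := posnP n; rewrite expnS expn1 leq_pmull.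
- exact: cvg_cst.
- exact: cvg_harmonic.
Unshelve. all: end_near. Qed.

(** The integral over a growing symmetric interval is a difference of two values of [V], which tend
    to 0; domination of [v] passes to the limit. *)
Lemma integral_derivative_eq0 (V v : R -> R) (M : R) :
  (forall x : R, is_derive x 1 V (v x)) -> continuous v ->
  (forall x, `|v x| <= M * (1 + x ^+ 2)^-1) ->
  (forall x, `|V x| <= M * (1 + x ^+ 2)^-1) ->
  (\int[mu]_x (v x)%:E = 0)%E.
Proof.
move=> dV cv vM VM.
pose vE : R -> \bar R := EFin \o v.
(* With [n.+1] no interval is degenerate, as the fundamental theorem of calculus requires. *)
pose A n := `[(- n.+1%:R : R), n.+1%:R]%classic.
have vint := integrable_dominated cv vM.
have mv : measurable_fun setT (EFin \o v).
  by apply/measurable_EFinP; exact: continuous_measurable_fun.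
have [] := @dominated_convergence _ _ R mu setT measurableT
  (fun n => vE \_ (A n)) vE (EFin \o (fun x => M * (1 + x ^+ 2)^-1)).
- move=> n; apply/(measurable_restrictT _ _).1 => //; first exact: measurable_itv.
  exact: measurable_funTS.
- exact: mv.
- apply: aeW => x _; apply: cvg_near_cst.
  near=> n; rewrite patchE mem_set// /A /= in_itv/= -ler_norml.
  near: n; exists (Num.bound `|x|) => // n /= xn.
  apply: (@le_trans _ _ (Num.bound `|x|)%:R); first by rewrite ltW// archi_boundP.
  by rewrite ler_nat (leq_trans xn).
- exact: integrable_cauchyZ.
- apply: aeW => x n _; rewrite patchE; case: ifP => _ /=.
    by rewrite lee_fin.
  by rewrite ?normr0 lee_fin (le_trans _ (vM x)).
move=> _ _ /= H1.
apply: (cvg_unique _ H1) => //.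
have -> : (fun n => \int[mu]_x (vE \_ (A n)) x)%E =
    (fun n => (V n.+1%:R - V (- n.+1%:R))%:E).
  apply/funext => n; rewrite -integral_mkcond /A.
  rewrite (@continuous_FTC2 _ v V)//.
  - by rewrite gtrN.
  - by apply: continuous_subspaceT.
  - have cV x : {for x, continuous V} by apply/differentiable_continuous/derivable1_diffP.
    split; first by move=> x _; case: (dV x).
    + by apply: cvg_at_right_filter; exact: cV.
    + by apply: cvg_at_left_filter; exact: cV.
  - by move=> x _; rewrite derive1E; case: (dV x).
apply: cvg_EFin; first by near=> n.
rewrite -(subr0 0).
(* The sign s = 1 or s = -1 treats both endpoints together. *)
have H (s : R) : s ^+ 2 = 1 -> (fun n => V (s * n.+1%:R)) @ \oo --> (0 : R).
  move=> s1; apply/norm_cvg0P.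
  apply: (@squeeze_cvgr _ _ _ _ (fun=> 0) (fun n => M * (1 + n.+1%:R ^+ 2)^-1)).
  - near=> n; rewrite normr_ge0/=.
    by apply: (le_trans (VM _)); rewrite exprMn s1 mul1r.
  - exact: cvg_cst.
  - by have := cvg_cauchy0 M; rewrite -(cvg_shiftS (fun n => M * (1 + n%:R ^+ 2)^-1)).
apply: cvgB.
  by have := H 1 (expr1n _ _); under eq_fun do rewrite mul1r.
by have := H (-1); rewrite sqrrN expr1n => /(_ erefl); under eq_fun do rewrite mulN1r.
Unshelve. all: end_near. Qed.

End CauchyDensity.

(** * Shifting the vertical line: the integral for l = 1 *)

Section DelayIntegral.
Variables (R : realType) (a : R).
Hypotheses (a0 : 0 <= a) (api : a < pi / 2).
Implicit Types c w : R.
Notation mu := (@lebesgue_measure R).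
Local Notation q := (delayQ a).

Let F c w := kerF q (Complex c w) (cexpN a c w).
Let F' c w := kerF' a q (Complex c w) (cexpN a c w).

Let dF_re c w : 0 < c -> cderive (F^~ w) c (F' c w).
Proof.
move=> c0; rewrite -[F' c w]mulr1.
apply: (cderive_kerF q (cderive_line_re w c) (cderive_cexpN_re a w c)).
- by apply: characteristic_neq0; rewrite // ltW.
- by apply: oneD_neq0; rewrite ltW.
- exact: oneDsqr_neq0.
Qed.

Let dF_im c w : 0 < c -> cderive (F c) w (F' c w * 'i%C).
Proof.
move=> c0.
apply: (cderive_kerF q (cderive_line_im c w) (cderive_cexpN_im a c w)).
- by apply: characteristic_neq0; rewrite // ltW.
- by apply: oneD_neq0; rewrite ltW.
- exact: oneDsqr_neq0.
Qed.

Let dF'_im c w : 0 < c -> exists d, cderive (F' c) w d.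
Proof.
move=> c0.
apply: (cderive_kerF' q (cderive_line_im c w) (cderive_cexpN_im a c w)).
- by apply: characteristic_neq0; rewrite // ltW.
- by apply: oneD_neq0; rewrite ltW.
- exact: oneDsqr_neq0.
Qed.

Let u c w := complex.Re (F c w).

Let cu c : 0 < c -> continuous (u c).
Proof. by move=> c0 w; exact: cderive_continuous_Re (dF_im w c0). Qed.

Let u_int c : 0 < c -> mu.-integrable setT (EFin \o u c).
Proof.
move=> c0; have [M M0 Mle] := normc_kerF_le a0 api.
apply: (@integrable_dominated _ _ M); first exact: cu.
by move=> w; apply: le_trans (Mle c w c0); exact: ler_Re_normc.
Qed.

Let d1u c w : 0 < c -> partial1of2 u c w = complex.Re (F' c w).
Proof. by move=> c0; rewrite partial1of2E; have [/@derive_val] := dF_re w c0. Qed.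

Let I c := (\int[mu]_(w in setT) u c w).

(* Cauchy-Riemann: the c-derivative of Re F is the w-derivative of Im F, whose
   integral over a vertical line vanishes. *)
Let dI c : 0 < c -> is_derive c 1 I 0.
Proof.
move=> c0; have c20 : 0 < c / 2 by rewrite divr_gt0.
have [M M0 Mle] := normc_kerF'_le a0 api c20.
have [N N0 Nle] := normc_kerF_le a0 api.
(* This neighbourhood of c stays to the right of c / 2, where the bound on F' holds. *)
have cI : `]c / 2, c + 1[%classic c.
  by rewrite /= in_itv/= ltrDl ltr01 andbT ltr_pdivrMr// mulr_natr mulr2n ltrDl.
have i1 x : `]c / 2, c + 1[%classic x -> mu.-integrable setT (EFin \o u x).
  by rewrite /= in_itv/= => /andP[cx _]; apply: u_int; exact: lt_trans cx.
have i2 x y : `]c / 2, c + 1[%classic x -> setT y -> derivable (u ^~ y) x 1.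
  rewrite /= in_itv/= => /andP[cx _] _.
  by have [[]] := dF_re y (lt_trans c20 cx).
have i3 y : 0 <= M * (1 + y ^+ 2)^-1 by rewrite mulr_ge0 ?invr_ge0 ?ltW ?oneDw_gt0.
have i4 x y : `]c / 2, c + 1[%classic x -> setT y ->
    `|partial1of2 u x y| <= M * (1 + y ^+ 2)^-1.
  rewrite /= in_itv/= => /andP[cx _] _; rewrite d1u; last exact: lt_trans cx.
  by apply: le_trans (Mle x y cx); exact: ler_Re_normc.
have dI1 := derivable_under_integral measurableT cI i1 i2 i3 (integrable_cauchyZ M) i4.
have dI2 := differentiation_under_integral measurableT cI i1 i2 i3 (integrable_cauchyZ M) i4.
have J : (\int[mu]_w (complex.Re (F' c w))%:E = 0)%E.
  have dV w : is_derive w 1 (fun w => complex.Im (F c w)) (complex.Re (F' c w)).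
    have [_ H] := dF_im w c0.
    by apply: (is_derive_eq H); rewrite ImiRe.
  apply: (integral_derivative_eq0 (M := Num.max M N) dV).
  - by move=> w; have [d] := dF'_im w c0; exact: cderive_continuous_Re.
  - move=> w; apply: (le_trans (ler_Re_normc _)).
    have cc : c / 2 < c by rewrite ltr_pdivrMr// mulr_natr mulr2n ltrDl.
    apply: (le_trans (Mle c w cc)); rewrite ler_wpM2r ?le_max ?lexx//.
    by rewrite invr_ge0 ltW// oneDw_gt0.
  - move=> w; apply: (le_trans (ler_Im_normc _)).
    apply: (le_trans (Nle c w c0)); rewrite ler_wpM2r ?le_max ?lexx ?orbT//.
    by rewrite invr_ge0 ltW// oneDw_gt0.
apply: DeriveDef => //; rewrite -derive1E dI2 /Rintegral.
by under eq_integral do rewrite d1u//; rewrite J.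
Qed.

Let I_cst c : 0 < c -> I c = I 1.
Proof.
have H x y : 0 < x -> x <= y -> I x = I y.
  move=> x0 xy; apply/eqP; rewrite eq_sym -subr_eq0.
  have [||z _ ->] := @MVT_segment _ I (fun=> 0) x y xy.
  - by move=> t; rewrite in_itv/= => /andP[xt _]; apply: dI; exact: lt_trans xt.
  - apply: continuous_in_subspaceT => t; rewrite inE/= in_itv/= => /andP[xt _].
    have := dI (lt_le_trans x0 xt).
    by move=> ?; apply/differentiable_continuous/derivable1_diffP.
  - by rewrite mul0r.
move=> c0; have [c1|/ltW c1] := leP c 1; first exact: H.
by apply/esym/H.
Qed.

(** As [I] is constant, dominated convergence makes the integral of every almost everywhere limit
    equal to [I 1]. It is applied along c = n + 1, with limit 0, and along c = 1 / (n + 1), with the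
    boundary values of Re F. *)
Let I_lim (c_ : nat -> R) (f : R -> R) : (forall n, 0 < c_ n) ->
  measurable_fun setT f ->
  {ae mu, forall w, (u (c_ n) w) @[n --> \oo] --> f w} ->
  mu.-integrable setT (EFin \o f) /\ (\int[mu]_w (f w)%:E = (I 1)%:E)%E.
Proof.
move=> cn0 mf cvf; have [M M0 Mle] := normc_kerF_le a0 api.
have [] := @dominated_convergence _ _ R mu setT measurableT
  (fun n => EFin \o u (c_ n)) (EFin \o f) (EFin \o (fun x => M * (1 + x ^+ 2)^-1)).
- by move=> n; have /integrableP[] := u_int (cn0 n).
- exact/measurable_EFinP.
- have [N [mN N0 sN]] := cvf; exists N; split => // w nw; apply: sN => /= cw.
  by apply: nw => _; apply: cvg_EFin => //; near=> n.
- exact: integrable_cauchyZ.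
- apply: aeW => w n _ /=; rewrite lee_fin.
  by apply: le_trans (Mle _ w (cn0 n)); exact: ler_Re_normc.
move=> fint _ /= H1; split => //; apply/esym; apply: (cvg_unique _ _ H1) => //.
have -> : (fun n => \int[mu]_x (u (c_ n) x)%:E)%E = (fun=> (I 1)%:E).
  apply/funext => n; rewrite -(I_cst (cn0 n)) /I /Rintegral fineK//.
  by apply: integrable_fin_num => //; exact: u_int.
exact: cvg_cst.
Unshelve. all: end_near. Qed.

Let I1_eq0 : I 1 = 0.
Proof.
have := @I_lim (fun n => n.+1%:R) (fun=> 0).
rewrite integral0 => H; apply/esym/EFin_inj; apply: (H _ _ _).2 => //.
apply: aeW => w; have [M M0 Mle] := normc_kerF_le_sqr a0 api.
apply/norm_cvg0P.
apply: (@squeeze_cvgr _ _ _ _ (fun=> 0) (fun n => M * (n.+1%:R^-1 ^+ 2))).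
- near=> n; rewrite normr_ge0/=.
  by apply: (le_trans (ler_Re_normc _)); exact: Mle.
- exact: cvg_cst.
- rewrite -[X in _ --> X](mulr0 M); apply: cvgM; first exact: cvg_cst.
  rewrite -[X in _ --> X](mulr0 0); under eq_fun do rewrite expr2.
  by apply: cvgM; exact: cvg_harmonic.
Unshelve. all: end_near. Qed.

Definition delay_den w := 1 + w ^+ 2 - 2 * w * sin (a * w).

Lemma delay_denE w : delay_den w = normc (cexpN a 0 w + Complex 0 w) ^+ 2.
Proof.
rewrite normc_sqr /= mulr0 oppr0 expR0 !mul1r addr0 cos2sin2 /delay_den; ring.
Qed.

Lemma delay_den_gt0 w : 0 < delay_den w.
Proof. by rewrite delay_denE exprn_gt0// normc_gt0 characteristic_neq0. Qed.

Lemma continuous_delay_denV : continuous (fun w => (delay_den w)^-1).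
Proof.
move=> w; apply: cvgV; first by rewrite gt_eqF// delay_den_gt0.
apply: cvgB; first exact: continuous_oneDsqr.
apply: cvgM; first by apply: cvgM; [exact: cvg_cst|exact: cvg_id].
apply: (@continuous_comp _ _ _ (fun w => a * w) sin); last exact: continuous_sin.
by apply: cvgM; [exact: cvg_cst|exact: cvg_id].
Qed.

Let Re_div (x y : R[i]) : complex.Re (x * y^-1) =
  (complex.Re x * complex.Re y + complex.Im x * complex.Im y) / normc y ^+ 2.
Proof. by rewrite normc_sqr; case: x y => [x1 x2] [y1 y2] /=; ring. Qed.

(** At z = iw the factor 1 + z^2 = 1 - w^2 is real. Since |e| = 1, Re ((e - z) / (e + z)) has
    numerator |e|^2 - |z|^2 = 1 - w^2, and Re ((z - 1) / (z + 1)) = - (1 - w^2) / (1 + w^2), so this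
    factor cancels. *)
Let u0 w : w != 1 -> w != -1 -> u 0 w = (delay_den w)^-1 - q * (1 + w ^+ 2)^-1.
Proof.
move=> w1 w1'; have d0 := delay_den_gt0 w; have W0 := oneDw_gt0 w.
have w2 : 1 - w ^+ 2 != 0.
  by rewrite subr_eq0 eq_sym sqrf_eq1 negb_or w1.
rewrite /u /F /kerF kerP_frac ?characteristic_neq0 ?oneD_neq0//.
have -> : 1 + Complex 0 w * Complex 0 w = (1 - w ^+ 2)%:C%C.
  by apply/eqP; rewrite eq_complex /=; apply/andP; split; apply/eqP; ring.
have Re_real (r : R) x : complex.Re (r%:C%C * x) = r * complex.Re x.
  by case: x => ? ? /=; rewrite mul0r subr0.
rewrite -fmorphV mulrC Re_real Re_addc Re_real !Re_div -delay_denE.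
rewrite normc_sqr /= mulr0 oppr0 expR0 !mul1r !addr0.
have cs := cos2Dsin2 (a * w).
have -> : cos (a * w) * cos (a * w) +
  (- sin (a * w) - w) * (- sin (a * w) + w) = 1 - w ^+ 2 by rewrite -cs; ring.
by field; rewrite w2 (gt_eqF d0)/= gt_eqF.
Qed.

(** Away from the poles F is differentiable along the horizontal line at c = 0 too, hence continuous
    there. *)
Let u_cvg0 w : w != 1 -> w != -1 ->
  u n.+1%:R^-1 w @[n --> \oo] --> (delay_den w)^-1 - q * (1 + w ^+ 2)^-1.
Proof.
move=> w1 w1'; rewrite -u0//.
have r0 : 1 + Complex 0 w * Complex 0 w != 0.
  rewrite eq_complex /= negb_and; apply/orP; left.
  by rewrite mul0r sub0r subr_eq0 eq_sym -expr2 sqrf_eq1 negb_or w1.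
have := cderive_kerF q (cderive_line_re w 0) (cderive_cexpN_re a w 0)
  (characteristic_neq0 a0 api w (lexx 0)) (oneD_neq0 w (lexx 0)) r0.
move=> /cderive_continuous_Re cu0.
apply: (cvg_comp (fun n => n.+1%:R^-1) (u ^~ w) _ cu0).
exact: cvg_harmonic.
Qed.

Let f w := (delay_den w)^-1 - q * (1 + w ^+ 2)^-1.

Let f_int : mu.-integrable setT (EFin \o f) /\ (\int[mu]_w (f w)%:E = 0)%E.
Proof.
have cf : continuous f.
  move=> w; apply: cvgB; first exact: continuous_delay_denV.
  by apply: cvgM; [exact: cvg_cst | exact: continuous_cauchy].
have mf := continuous_measurable_fun cf.
have -> : (0 = (I 1)%:E)%E by rewrite I1_eq0.
apply: (@I_lim (fun n => n.+1%:R^-1)) => //.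
(* The null set of boundary poles, left out of the pointwise limit. *)
exists [set 1; -1]; split.
- by apply: measurableU; exact: measurable_set1.
- by apply: null_set_setU => //; exact: lebesgue_measure_set1.
- move=> w /= nw; apply: contrapT => w1; apply: nw.
  by apply: u_cvg0; apply/eqP => w1'; apply: w1; [left|right].
Qed.

Let delay_denVE : (EFin \o (fun w => (delay_den w)^-1)) =
  (EFin \o f) \+ (EFin \o (fun w => q * (1 + w ^+ 2)^-1))%R.
Proof. by apply/funext => w /=; rewrite -EFinD subrK. Qed.

Lemma integrable_delay_denV : mu.-integrable setT (EFin \o (fun w => (delay_den w)^-1)).
Proof. by rewrite delay_denVE; apply: integrableD (integrable_cauchyZ q) => //; case: f_int. Qed.

Lemma integral_delay_denV : (\int[mu]_w ((delay_den w)^-1)%:E = (pi * q)%:E)%E.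
Proof.
have [fi f0] := f_int.
pose g w := q * (1 + w ^+ 2)^-1.
transitivity (\int[mu]_w ((EFin \o f) w + (EFin \o g) w))%E.
  by apply: eq_integral => w _ /=; rewrite -EFinD subrK.
rewrite integralD//; last exact: integrable_cauchyZ.
rewrite f0 add0e.
transitivity (\int[mu]_w (q%:E * ((1 + w ^+ 2)^-1)%R%:E))%E; first by [].
by rewrite integralZl//; [rewrite integral_cauchy -EFinM mulrC | exact: integrable_cauchy].
Qed.

End DelayIntegral.

(** * Rescaling to an arbitrary positive eigenvalue *)

Section ScaledDelayIntegral.
Variables (R : realType) (tau lam : R).
Hypotheses (tau0 : 0 <= tau) (lam0 : 0 < lam) (taulam : tau * lam < pi / 2).
Notation mu := (@lebesgue_measure R).

(** The squared modulus of i om + lam e^(-i tau om), the characteristic function of one mode on the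
    imaginary axis. *)
Definition modal_den (om : R) : R := om ^+ 2 + lam ^+ 2 - 2 * lam * om * sin (tau * om).

Let a0 : 0 <= tau * lam. Proof. by rewrite mulr_ge0// ltW. Qed.

Lemma modal_denE om : modal_den om = lam ^+ 2 * delay_den (tau * lam) (om / lam).
Proof.
rewrite /delay_den (_ : tau * lam * (om / lam) = tau * om); last by field; rewrite gt_eqF.
by rewrite /modal_den; field; rewrite gt_eqF.
Qed.

Lemma modal_den_gt0 om : 0 < modal_den om.
Proof. by rewrite modal_denE mulr_gt0 ?exprn_gt0// delay_den_gt0. Qed.

Lemma continuous_modal_denV : continuous (fun om => (modal_den om)^-1).
Proof.
move=> w; apply: cvgV; first by rewrite gt_eqF// modal_den_gt0.
apply: cvgB; first by apply: cvgD; [exact: exprn_continuous|exact: cvg_cst].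
apply: cvgM; first by apply: cvgM; [exact: cvg_cst|exact: cvg_id].
apply: (@continuous_comp _ _ _ (fun w => tau * w) sin); last exact: continuous_sin.
by apply: cvgM; [exact: cvg_cst|exact: cvg_id].
Qed.

(** Substitute om = lam x: the Jacobian lam against the factor lam^2 of the denominator leaves 1 /
    lam. *)
Lemma integral_modal_denV :
  (\int[mu]_om ((modal_den om)^-1)%:E = (pi * (delayQ (tau * lam) / lam))%:E)%E.
Proof.
pose G om := (modal_den om)^-1.
have dF (x : R) : is_derive x 1 ( *%R lam : R -> R) lam.
  by apply: is_derive_eq; rewrite /GRing.scale /= mulr1 ?mulr0 ?addr0.
have dF1 : derive1 ( *%R lam : R -> R) = (fun=> lam).
  by apply/funext => x; rewrite derive1E; apply: derive_val.
rewrite (@increasing_ge0_integration_by_substitutionT _ ( *%R lam) G).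
- rewrite dF1.
  transitivity (\int[mu]_x ((lam^-1)%:E * ((delay_den (tau * lam) x)^-1)%:E))%E.
    apply: eq_integral => x _; rewrite /G /= -EFinM; congr EFin.
    rewrite mulrfctE /= modal_denE (mulrC lam x) mulfK ?gt_eqF//.
    have := delay_den_gt0 a0 taulam x => d0.
    by field; rewrite !gt_eqF.
  rewrite integralZl//; last exact: integrable_delay_denV.
  by rewrite integral_delay_denV// -EFinM; congr EFin; ring.
- by move=> x y xy; rewrite ltr_pM2l.
- by rewrite dF1 => x; exact: cvg_cst.
- by rewrite dF1; exact: is_cvg_cst.
- by rewrite dF1; exact: is_cvg_cst.
- by move=> x; case: (dF x).
- by apply: gt0_cvgMrNy => //; exact: cvg_id.
- by apply: gt0_cvgMry => //; exact: cvg_id.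
- exact: continuous_modal_denV.
- by move=> x; rewrite invr_ge0 ltW// modal_den_gt0.
Qed.

Lemma integrable_modal_denV : mu.-integrable setT (EFin \o (fun om => (modal_den om)^-1)).
Proof.
apply/integrableP; split.
  apply/measurable_EFinP; apply: (@continuous_measurable_fun R).
  exact: continuous_modal_denV.
under eq_integral do rewrite /= ger0_norm ?invr_ge0 ?(ltW (modal_den_gt0 _))//.
by rewrite integral_modal_denV ltry.
Qed.

End ScaledDelayIntegral.

(** * Spectral calculus and the Laplacian *)

Section SpectralResolution.
Variables (R : realType) (n : nat).
Implicit Types (L : 'M[R]_n.+1) (p q : {poly R}).

Lemma trmx_horner L p : (horner_mx L p)^T = horner_mx L^T p.
Proof.
elim/poly_ind: p => [|p c IH]; first by rewrite !rmorph0 trmx0.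
rewrite !rmorphD !rmorphM /= !horner_mx_X !horner_mx_C raddfD /= tr_scalar_mx.
congr (_ + _); rewrite trmx_mul IH.
by apply/esym/comm_horner_mx.
Qed.

(* A real symmetric matrix is unitarily diagonalizable over R[i] with real
   eigenvalues, hence a polynomial in it only depends on its values there. *)
Lemma symmetric_horner_eq L : L^T = L -> exists2 s : seq R, uniq s &
  forall p q, {in s, forall x, p.[x] = q.[x]} -> horner_mx L p = horner_mx L q.
Proof.
move=> Lsym; pose LC := map_mx (real_complex R) L.
have LCherm : LC \is hermsymmx.
  apply: realsym_hermsym.
    apply/is_hermitianmxP; rewrite expr0 scale1r map_mx_id//.
    by apply/matrixP => i j; rewrite !mxE -{1}Lsym mxE.
  by apply/mxOverP => i j; rewrite mxE complex_real.
have [U [D [Uu dreal LCE]]] : exists U D,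
    [/\ U \in unitmx, D \is a realmx & LC = invmx U *m diag_mx D *m U].
  exists (spectralmx LC), (spectral_diag LC); split.
  - exact: spectral_unit.
  - exact: hermitian_spectral_diag_real.
  - exact/orthomx_spectralP/hermitian_normalmx.
exists (undup [seq complex.Re (D 0 i) | i <- enum 'I_n.+1]); first exact: undup_uniq.
pose W p := map_mx (horner (map_poly (real_complex R) p)) D.
have hE p : map_mx (real_complex R) (horner_mx L p) = invmx U *m diag_mx (W p) *m U.
  by rewrite map_horner_mx -horner_mx_diag -horner_mx_uconjC// -LCE.
move=> p q pq; apply: (map_mx_inj (f := real_complex R)).
suff WW : W p = W q by rewrite !hE WW.
apply/matrixP => i j; rewrite !mxE ord1.
have <- : (complex.Re (D 0 j))%:C%C = D 0 j by apply: RRe_real; exact: (mxOverP _ _).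
rewrite !horner_map pq// mem_undup; apply/mapP; exists j => //.
by rewrite mem_enum.
Qed.

Lemma symmetric_spectral_resolution L : L^T = L ->
  exists r (l : 'I_r -> R) (E : 'I_r -> 'M[R]_n.+1),
  [/\ forall i, eigenvalue L (l i), forall i, (E i)^T = E i,
      forall i j, E i *m E j = if i == j then E i else 0,
      \sum_i E i = 1%:M & \sum_i l i *: E i = L].
Proof.
move=> Lsym; have [s0 us0 key] := symmetric_horner_eq Lsym.
pose lag (x : R) : {poly R} := \prod_(y <- s0 | y != x) ((x - y)^-1 *: ('X - y%:P)).
have lagE x y : x \in s0 -> y \in s0 -> (lag x).[y] = (x == y)%:R.
  move=> xs ys; rewrite horner_prod; have [<-|xy] := eqVneq x y.
    rewrite big1// => z zx; rewrite !hornerE mulVf// subr_eq0 eq_sym//.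
  rewrite (big_rem y)//= eq_sym xy !hornerE subrr mulr0 mul0r//.
pose E0 x := horner_mx L (lag x).
(* Points with zero projection are dropped; for the others [E0L] turns a nonzero row of [E0 x] into
   an eigenvector. *)
pose s := [seq x <- s0 | E0 x != 0].
have ss0 x : x \in s -> x \in s0 by rewrite mem_filter => /andP[].
have us : uniq s by rewrite filter_uniq.
have E0L x : x \in s0 -> E0 x *m L = x *: E0 x.
  move=> xs; rewrite -[X in _ *m X](horner_mx_X L) -[_ *m _](rmorphM (horner_mx L)).
  rewrite -horner_mxZ; apply: key => y ys; rewrite !hornerE lagE//.
  by have [->|] := eqVneq x y; rewrite ?mul1r ?mulr1 ?mul0r ?mulr0.
have sumE (f : R -> R) : \sum_(i < size s) f (s`_i) *: E0 (s`_i) = \sum_(x <- s0) f x *: E0 x.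
  rewrite [RHS](bigID (fun x => E0 x != 0)) /= [X in _ = _ + X]big1 ?addr0; last first.
    by move=> x; rewrite negbK => /eqP ->; rewrite scaler0.
  by rewrite -[RHS]big_filter -/s (big_nth 0) big_mkord.
have sumE1 : \sum_(x <- s0) E0 x = 1%:M.
  rewrite -[RHS](horner_mx_C L) /E0 -(rmorph_sum (horner_mx L)); apply: key => y ys.
  rewrite horner_sum hornerC (big_rem y)//= lagE// eqxx big_seq big1 ?addr0// => x.
  rewrite (rem_filter _ us0) mem_filter /= => /andP[xy xs].
  by rewrite lagE// (negbTE xy).
exists (size s), (fun i => s`_i), (fun i => E0 s`_i); split.
- move=> i; have si : s`_i \in s by rewrite mem_nth.
  have := si; rewrite mem_filter => /andP[E0n si0].
  have [j rj] : exists j, row j (E0 s`_i) != 0.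
    apply/existsP; rewrite -[[exists _, _]]negbK negb_exists.
    apply: contra E0n => /forallP rj; apply/eqP/row_matrixP => j.
    by rewrite row0; have := rj j; rewrite negbK => /eqP.
  apply/eigenvalueP; exists (row j (E0 s`_i)) => //.
  by rewrite -row_mul E0L// linearZ.
- by move=> i; rewrite /E0 trmx_horner Lsym.
- move=> i j; have si := ss0 _ (mem_nth 0 (ltn_ord i)).
  have sj := ss0 _ (mem_nth 0 (ltn_ord j)).
  rewrite /E0 -[_ *m _](rmorphM (horner_mx L)) /=.
  have -> : (i == j) = (s`_i == s`_j) by rewrite nth_uniq.
  have [->|sij] := eqVneq s`_i s`_j.
    by apply: key => y ys; rewrite hornerM lagE//; case: eqP; rewrite ?mulr1 ?mulr0.
  rewrite -[RHS](rmorph0 (horner_mx L)).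
  apply: key => y ys; rewrite hornerM !lagE// horner0.
  by have [<-|] := eqVneq s`_i y; rewrite ?mul0r// eq_sym (negbTE sij) mulr0.
- rewrite -sumE1; transitivity (\sum_(x <- s0) (1 : R) *: E0 x).
    by rewrite -(sumE (fun=> 1)); apply: eq_bigr => i _; rewrite scale1r.
  by apply: eq_bigr => x _; rewrite scale1r.
- rewrite (sumE id) -[RHS]mul1mx.
  rewrite -sumE1 mulmx_suml big_seq [RHS]big_seq; apply: eq_bigr => x xs.
  by rewrite E0L.
Qed.

End SpectralResolution.

(** * Functional calculus for a resolution of the identity *)

Section SpectralCalculus.
Variables (K : fieldType) (n r : nat) (E : 'I_r -> 'M[K]_n).
Hypothesis E_orth : forall i j, E i *m E j = if i == j then E i else 0.
Hypothesis E_sum : \sum_i E i = 1%:M.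
Implicit Types f g : 'I_r -> K.

(** The matrix acting as [f i] on the range of [E i]. It respects sums and products in [f], so
    matrix identities become pointwise ones; the field is general to serve both real and complex
    matrices. *)
Definition spec f : 'M[K]_n := \sum_i f i *: E i.

Lemma eq_spec f g : f =1 g -> spec f = spec g.
Proof. by move=> fg; apply: eq_bigr => i _; rewrite fg. Qed.

Lemma spec1 : spec (fun=> 1) = 1%:M.
Proof. by rewrite -E_sum; apply: eq_bigr => i _; rewrite scale1r. Qed.

Lemma specD f g : spec f + spec g = spec (fun i => f i + g i).
Proof. by rewrite -big_split; apply: eq_bigr => i _; rewrite scalerDl. Qed.

Lemma specB f g : spec f - spec g = spec (fun i => f i - g i).
Proof. by rewrite -sumrB; apply: eq_bigr => i _; rewrite scalerBl. Qed.

Lemma specZ c f : c *: spec f = spec (fun i => c * f i).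
Proof. by rewrite scaler_sumr; apply: eq_bigr => i _; rewrite scalerA. Qed.

Lemma specM f g : spec f *m spec g = spec (fun i => f i * g i).
Proof.
rewrite mulmx_suml; apply: eq_bigr => i _.
rewrite mulmx_sumr (bigD1 i)//= big1 ?addr0.
  by rewrite -scalemxAl -scalemxAr E_orth eqxx scalerA.
by move=> j ji; rewrite -scalemxAl -scalemxAr E_orth eq_sym (negbTE ji) !scaler0.
Qed.

Lemma specX f k : spec f ^+ k = spec (fun i => f i ^+ k).
Proof.
elim: k => [|k IH]; first by rewrite expr0 -[1]/(1%:M) -spec1; apply: eq_spec => i; rewrite expr0.
by rewrite exprS IH [LHS]specM; apply: eq_spec => i; rewrite exprS.
Qed.

Lemma spec_entry f i j : spec f i j = \sum_k f k * E k i j.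
Proof. by rewrite summxE; apply: eq_bigr => k _; rewrite mxE. Qed.

Lemma spec_tr f : (forall i, (E i)^T = E i) -> (spec f)^T = spec f.
Proof.
move=> ET; apply/matrixP => i j; rewrite mxE !spec_entry.
by apply: eq_bigr => k _; rewrite -{1}ET mxE.
Qed.

Lemma invmx_spec f : (forall i, f i != 0) -> invmx (spec f) = spec (fun i => (f i)^-1).
Proof.
move=> f0; have ff : spec f *m spec (fun i => (f i)^-1) = 1%:M.
  by rewrite specM -spec1; apply: eq_spec => i; rewrite divff.
have [fu _] := mulmx1_unit ff.
by rewrite -[LHS]mulmx1 -ff mulmxA mulVmx// mul1mx.
Qed.

End SpectralCalculus.

(** * The Moore-Penrose inverse *)

Section Penrose.
Variables (R : realType) (n : nat).
Implicit Types A X Y : 'M[R]_n.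

(** A X and A Y are symmetric and each absorbs the other on the left, so transposing a product gives
    A X = A Y; likewise X A = Y A. Then X = X A X = Y A Y = Y. *)
Lemma penrose_unique A X Y : penrose A X -> penrose A Y -> X = Y.
Proof.
move=> [x1 x2 x3 x4] [y1 y2 y3 y4].
have AXY : A *m X = A *m Y.
  rewrite -x3 -{1}y1 -[A *m Y *m A *m X]mulmxA trmx_mul x3 y3.
  by rewrite mulmxA x1.
have XYA : X *m A = Y *m A.
  have h : (Y *m A) *m (X *m A) = Y *m A by rewrite -mulmxA (mulmxA A) x1.
  have h' : (X *m A) *m (Y *m A) = X *m A by rewrite -mulmxA (mulmxA A) y1.
  by rewrite -[LHS]x4 -{1}h' trmx_mul y4 x4 h.
by rewrite -x2 XYA -mulmxA AXY mulmxA y2.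
Qed.

Lemma mp_pinv_eq A X : penrose A X -> mp_pinv A = X.
Proof.
move=> pX; apply: (@penrose_unique A) => //.
by rewrite /mp_pinv; case: xgetP => [Y -> //|/(_ X)].
Qed.

(** The convention that the inverse of 0 is 0 is the pseudo-inverse of scalars, so the Penrose
    equations hold mode by mode. *)
Lemma mp_pinv_spec r (E : 'I_r -> 'M[R]_n) (f : 'I_r -> R) :
  (forall i j, E i *m E j = if i == j then E i else 0) ->
  (forall i, (E i)^T = E i) ->
  mp_pinv (spec E f) = spec E (fun i => (f i)^-1).
Proof.
move=> Eo ET; apply: mp_pinv_eq; split.
- rewrite !specM//; apply: eq_spec => i.
  by have [->|f0] := eqVneq (f i) 0; rewrite ?mulr0// mulfVK.
- rewrite !specM//; apply: eq_spec => i.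
  by have [->|f0] := eqVneq (f i) 0; rewrite ?invr0 ?mulr0// mulVf// mul1r.
- by rewrite specM// spec_tr.
- by rewrite specM// spec_tr.
Qed.

End Penrose.

(** * Matrix cosine and sine *)

Section MatrixTrig.
Variables (R : realType) (n r : nat) (E : 'I_r -> 'M[R]_n) (f : 'I_r -> R).
Hypothesis E_orth : forall i j, E i *m E j = if i == j then E i else 0.
Hypothesis E_sum : \sum_i E i = 1%:M.

(** Each entry of a partial sum is a fixed combination of [r] scalar partial sums, one per mode, so
    the limit is taken mode by mode. *)
Let spec_lim (c_ : nat -> R) (p_ : nat -> nat) (g : R -> R) :
  (forall x, (fun N => \sum_(0 <= k < N) c_ k * x ^+ p_ k) @ \oo --> g x) ->
  \matrix_(i, j) limn (fun N => \sum_(0 <= k < N) (c_ k * (spec E f ^+ p_ k) i j))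
  = spec E (fun k => g (f k)).
Proof.
move=> cg; apply/matrixP => i j; rewrite mxE spec_entry; apply/cvg_lim => //.
have -> : (fun N => \sum_(0 <= k < N) c_ k * (spec E f ^+ p_ k) i j) =
    (fun N => \sum_(l < r) (\sum_(0 <= k < N) c_ k * f l ^+ p_ k) * E l i j).
  apply/funext => N; under [RHS]eq_bigr do rewrite mulr_suml.
  rewrite exchange_big; apply: eq_bigr => k _.
  by rewrite specX// spec_entry mulr_sumr; apply: eq_bigr => l _; rewrite mulrA.
apply: cvg_big => [|l _]; first exact: add_continuous.
by apply: cvgM; [exact: cg|exact: cvg_cst].
Qed.

Lemma mx_cos_spec : mx_cos (spec E f) = spec E (fun k => cos (f k)).
Proof.
apply: (spec_lim (c_ := fun k => (-1) ^+ k / ((2 * k)`!)%:R) (p_ := fun k => (2 * k)%N)).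
move=> x; have := @cvg_cos_coeff' R x; rewrite /series/= /cos_coeff'.
by under eq_fun do under eq_bigr do rewrite -mul2n mulrAC.
Qed.

Lemma mx_sin_spec : mx_sin (spec E f) = spec E (fun k => sin (f k)).
Proof.
apply: (spec_lim (c_ := fun k => (-1) ^+ k / ((2 * k).+1`!)%:R) (p_ := fun k => (2 * k).+1)).
move=> x; have := @cvg_sin_coeff' R x; rewrite /series/= /sin_coeff'.
by under eq_fun do under eq_bigr do rewrite -mul2n mulrAC.
Qed.

End MatrixTrig.

(** * The graph Laplacian: sign of the eigenvalues and kernel *)

Section Laplacian.
Variables (R : realType) (n : nat) (w : 'I_n -> 'I_n -> R).
Hypothesis gw : is_wgraph w.
Local Notation L := (laplacian w).

Lemma laplacian_sym : L^T = L.
Proof.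
have [ws _ _] := gw; apply/matrixP => i j; rewrite !mxE eq_sym (ws j i).
by case: eqP => [->|].
Qed.

Lemma laplacian_row_sum i : \sum_j L i j = 0.
Proof.
under eq_bigr do rewrite mxE; rewrite sumrB (bigD1 i)//= eqxx [X in _ + X - _]big1 ?addr0 ?subrr//.
by move=> j; rewrite eq_sym => /negbTE ->.
Qed.

(** The Dirichlet form of the graph. The degree part [D] is symmetrized by exchanging i and j;
    expanding the square gives it twice, minus twice the cross terms [C]. *)
Lemma laplacian_quadratic (x : 'I_n -> R) :
  \sum_j (\sum_i x i * L i j) * x j = 2^-1 * \sum_i \sum_j w i j * (x i - x j) ^+ 2.
Proof.
have [ws _ _] := gw.
pose D := \sum_i \sum_j w i j * x i ^+ 2; pose C := \sum_i \sum_j w i j * (x i * x j).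
have -> : \sum_j (\sum_i x i * L i j) * x j = D - C.
  under eq_bigr do rewrite mulr_suml; rewrite exchange_big /= -sumrB.
  apply: eq_bigr => i _; under eq_bigr do rewrite mxE mulrBr mulrBl.
  rewrite sumrB; congr (_ - _); last by apply: eq_bigr => j _; ring.
  rewrite (bigD1 i)//= eqxx [X in _ + X]big1 ?addr0 -?mulr_suml; last first.
    by move=> j; rewrite eq_sym => /negbTE ->; rewrite mulr0 mul0r.
  by rewrite expr2; ring.
have DE : D = \sum_i \sum_j w i j * x j ^+ 2.
  by rewrite /D exchange_big; apply: eq_bigr => i _; apply: eq_bigr => j _; rewrite ws.
have -> : \sum_i \sum_j w i j * (x i - x j) ^+ 2 = D + D - (C + C).
  rewrite {2}DE /D /C -!big_split -sumrB; apply: eq_bigr => i _ /=.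
  by rewrite -!big_split -sumrB; apply: eq_bigr => j _ /=; ring.
by field.
Qed.

Lemma laplacian_eigenvalue_ge0 a : eigenvalue L a -> 0 <= a.
Proof.
have [_ w0 _] := gw.
move=> /eigenvalueP[v vL v0].
have v2 : 0 < \sum_j v 0 j ^+ 2.
  rewrite lt_neqAle sumr_ge0 ?andbT; last by move=> j _; rewrite sqr_ge0.
  apply: contra v0 => /eqP/esym/eqP; rewrite psumr_eq0; last by move=> j _; rewrite sqr_ge0.
  move=> /allP v0; apply/eqP/rowP => j; rewrite mxE; apply/eqP.
  by have := v0 j; rewrite mem_index_enum sqrf_eq0; exact.
have : a * \sum_j v 0 j ^+ 2 = \sum_j (\sum_i v 0 i * L i j) * v 0 j.
  rewrite mulr_sumr; apply: eq_bigr => j _.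
  by have /rowP/(_ j) := vL; rewrite !mxE => ->; ring.
rewrite laplacian_quadratic => av.
rewrite -(pmulr_lge0 _ v2) av mulr_ge0 ?invr_ge0//.
by apply: sumr_ge0 => i _; apply: sumr_ge0 => j _; rewrite mulr_ge0// sqr_ge0.
Qed.

(** A vanishing Dirichlet form has only zero terms, so x agrees across every edge and then along
    every path. *)
Lemma laplacian_kernel (x : 'I_n -> R) : wconnected w ->
  (forall j, \sum_i x i * L i j = 0) -> forall i j, x i = x j.
Proof.
move=> cw xL; have [_ w0 _] := gw.
have Q0 : \sum_i \sum_j w i j * (x i - x j) ^+ 2 == 0.
  have := laplacian_quadratic x; rewrite big1; last by move=> j _; rewrite xL mul0r.
  by move/esym/eqP; rewrite mulf_eq0 invr_eq0 pnatr_eq0.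
have t0 i j : 0 <= w i j * (x i - x j) ^+ 2 by rewrite mulr_ge0// sqr_ge0.
have edge i j : wedge w i j -> x i = x j.
  move=> wij; move: Q0; rewrite psumr_eq0; last by move=> k _; apply: sumr_ge0.
  move=> /allP/(_ i); rewrite mem_index_enum => /(_ isT) /=.
  rewrite psumr_eq0// => /allP/(_ j); rewrite mem_index_enum => /(_ isT) /=.
  by rewrite mulf_eq0 (gt_eqF wij) sqrf_eq0 subr_eq0 => /eqP.
move=> i j; have /connectP[p] := cw i j.
elim: p i => [i _ -> //|k p IH i /= /andP[ik kp] jl].
by rewrite (edge _ _ ik) (IH k).
Qed.

(** The kernel projection [P0] has rows in the kernel of L, hence constant rows by connectedness. It
    also equals 1 minus a multiple of L, so it fixes the all-ones vector and its rows sum to 1. Thus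
    every entry is 1 / n. *)
Lemma centering_spec r (E : 'I_r -> 'M[R]_n) (l : 'I_r -> R) : (0 < n)%N -> wconnected w ->
  (forall i j, E i *m E j = if i == j then E i else 0) ->
  (forall i, (E i)^T = E i) -> \sum_i E i = 1%:M -> spec E l = L ->
  centering R n = spec E (fun i => (l i != 0)%:R).
Proof.
move=> n0 cw Eo ET E1 EL.
pose P0 := spec E (fun i => (l i == 0)%:R).
have P0L : P0 *m L = 0.
  rewrite -EL specM// /spec big1// => i _.
  by have [->|] := eqVneq (l i) 0; rewrite ?mulr0 ?mul0r scale0r.
have P0c i j j' : P0 i j = P0 i j'.
  apply: (laplacian_kernel (x := P0 i)) => // k.
  by have /matrixP/(_ i k) := P0L; rewrite !mxE.
have one : P0 = 1%:M - spec E (fun i => (l i)^-1) *m L.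
  rewrite -EL specM// -(spec1 E1) specB; apply: eq_spec => i.
  by have [->|l0] := eqVneq (l i) 0; rewrite ?mulr0 ?subr0// mulVf// subrr.
have P0s i : \sum_j P0 i j = 1.
  have -> : \sum_j P0 i j = (P0 *m (const_mx 1 : 'cV_n)) i 0.
    by rewrite mxE; apply: eq_bigr => j _; rewrite mxE mulr1.
  rewrite one mulmxBl mul1mx -mulmxA (_ : L *m _ = 0) ?mulmx0 ?subr0 ?mxE//.
  apply/matrixP => k k'; rewrite mxE [RHS]mxE -[RHS](laplacian_row_sum k).
  by apply: eq_bigr => j _; rewrite [const_mx _ _ _]mxE mulr1.
have P0E : P0 = n%:R^-1 *: const_mx 1.
  apply/matrixP => i j; rewrite !mxE mulr1.
  have := P0s i; under eq_bigr do rewrite (P0c i _ j).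
  rewrite sumr_const card_ord => Pn.
  have nn0 : n%:R != 0 :> R by rewrite pnatr_eq0 -lt0n.
  by apply: (mulIf nn0); rewrite mulr_natr Pn mulVf.
rewrite /centering -P0E -(spec1 E1) specB; apply: eq_spec => i.
by case: (l i == 0); rewrite /= ?subrr ?subr0.
Qed.

End Laplacian.

(** * The transfer matrix in spectral form *)

Section Transfer.
Variables (R : realType) (n r : nat) (E : 'I_r -> 'M[R]_n).
Hypothesis E_orth : forall i j, E i *m E j = if i == j then E i else 0.
Hypothesis E_tr : forall i, (E i)^T = E i.
Hypothesis E_sum : \sum_i E i = 1%:M.
Let EC i := cmx (E i).

Let EC_orth i j : EC i *m EC j = if i == j then EC i else 0.
Proof. by rewrite /EC /cmx -map_mxM /= E_orth; case: eqP => // _; rewrite map_mx0. Qed.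

Let EC_sum : \sum_i EC i = 1%:M.
Proof. by rewrite /EC /cmx -map_mx_sum E_sum map_mx1. Qed.

Let cmxM p1 p2 p3 (A : 'M[R]_(p1, p2)) (C : 'M[R]_(p2, p3)) :
  cmx (A *m C) = cmx A *m cmx C.
Proof. exact: map_mxM. Qed.

Lemma cmx_spec f : cmx (spec E f) = spec EC (fun i => (f i)%:C%C).
Proof.
by apply/matrixP => i j; rewrite mxE !spec_entry rmorph_sum; apply: eq_bigr => k _;
  rewrite rmorphM mxE.
Qed.

Let spec_conj f : (map_mx conjc (spec EC f))^T = spec EC (fun i => conjc (f i)).
Proof.
apply/matrixP => i j; rewrite !mxE !spec_entry rmorph_sum; apply: eq_bigr => k _.
rewrite rmorphM; congr (_ * _).
by rewrite /EC !mxE -[in RHS]E_tr mxE; exact: conjc_real.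
Qed.

Lemma quad_spec m (B : 'M[R]_(n, m)) f k :
  (B^T *m spec E f *m B) k k = \sum_i f i * (B^T *m E i *m B) k k.
Proof.
rewrite mulmx_sumr mulmx_suml summxE; apply: eq_bigr => i _.
by rewrite -scalemxAr -scalemxAl mxE.
Qed.

(** The transfer matrix is [spec EC g] times real factors. Because the projections are real,
    symmetric and orthogonal, G^H G carries |g i|^2 on mode i, and the diagonal noise matrix puts
    sigma_k^2 on the k-th diagonal entry. *)
Lemma h2_integrand_spec m (B : 'M[R]_(n, m)) (sigma : 'I_m -> R) (l c : 'I_r -> R) tau om :
  centering R n = spec E c ->
  (forall i, Complex 0 om + Complex (cos (tau * om)) (- sin (tau * om)) * (l i)%:C%C != 0) ->
  h2_integrand (spec E l) B sigma tau om =
  \sum_i (c i ^+ 2 / (om ^+ 2 + l i ^+ 2 - 2 * l i * om * sin (tau * om))) *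
     \sum_k sigma k ^+ 2 * (B^T *m E i *m B) k k.
Proof.
move=> cE d0.
pose den i := Complex 0 om + Complex (cos (tau * om)) (- sin (tau * om)) * (l i)%:C%C.
pose g i := (c i)%:C%C * (den i)^-1.
pose G := transfer (spec E l) B sigma tau om.
pose S := diag_mx (\row_k sigma k).
have GE : G = spec EC g *m cmx B *m cmx S.
  rewrite /G /transfer cE !cmx_spec -(spec1 EC_sum) !specZ specD.
  rewrite [X in invmx X](_ : _ = spec EC den); last by apply: eq_spec => i; rewrite mulr1.
  by rewrite (invmx_spec EC_orth EC_sum d0) specM.
pose h i := c i ^+ 2 / (om ^+ 2 + l i ^+ 2 - 2 * l i * om * sin (tau * om)).
have ghE i : conjc (g i) * g i = (h i)%:C%C.
  have dd : conjc (den i) * den i =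
      (om ^+ 2 + l i ^+ 2 - 2 * l i * om * sin (tau * om))%:C%C.
    have cs : l i ^+ 2 = l i ^+ 2 * (cos (tau * om) ^+ 2 + sin (tau * om) ^+ 2).
      by rewrite cos2Dsin2 mulr1.
    rewrite /den cs; apply/eqP; rewrite eq_complex /=; apply/andP; split; apply/eqP; ring.
  have -> : conjc (g i) = (c i)%:C%C * (conjc (den i))^-1.
    by rewrite -[in RHS](conjc_real (c i)) -conjc_inv; exact: rmorphM.
  rewrite /g mulrACA -invfM dd -rmorphM -fmorphV -rmorphM.
  by rewrite /h expr2.
have cjr p p' (A : 'M[R]_(p, p')) : (map_mx conjc (cmx A))^T = cmx A^T.
  by apply/matrixP => i j; rewrite !mxE conjc_real.
have GGE : (map_mx conjc G)^T *m G = cmx (S *m (B^T *m spec E h *m B) *m S).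
  have -> : (map_mx conjc G)^T = cmx S *m cmx B^T *m spec EC (fun i => conjc (g i)).
    by rewrite GE !map_mxM !trmx_mul spec_conj !cjr tr_diag_mx mulmxA.
  have sg : spec EC (fun i => conjc (g i)) *m spec EC g = cmx (spec E h).
    by rewrite specM// cmx_spec; exact: eq_spec.
  by rewrite GE !cmxM -sg !mulmxA.
rewrite /h2_integrand -/G GGE /cmx trace_map_mx /= /mxtrace.
under [RHS]eq_bigr do rewrite mulr_sumr; rewrite exchange_big; apply: eq_bigr => k _ /=.
rewrite mul_mx_diag mxE [X in _ * X]mxE mul_diag_mx [X in X * _]mxE quad_spec.
rewrite [X in X * _ * _]mxE mulrC mulrA mulr_sumr.
by apply: eq_bigr => i _; rewrite /h; ring.
Qed.

End Transfer.

(** * Integration over all frequencies and conclusion *)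

Section Main.
Variables (R : realType) (n m : nat) (w : 'I_n -> 'I_n -> R).
Variables (B : 'M[R]_(n, m)) (sigma : 'I_m -> R) (tau lambda_n : R).
Hypotheses (n0 : (0 < n)%N) (gw : is_wgraph w) (cw : wconnected w).
Hypotheses (tau0 : 0 <= tau) (maxl : largest_eigenvalue (laplacian w) lambda_n).
Hypothesis taul : tau * lambda_n < pi / 2.
Local Notation L := (laplacian w).
Variables (r : nat) (l : 'I_r -> R) (E : 'I_r -> 'M[R]_n).
Hypothesis l_eigen : forall i, eigenvalue L (l i).
Hypothesis E_tr : forall i, (E i)^T = E i.
Hypothesis E_orth : forall i j, E i *m E j = if i == j then E i else 0.
Hypothesis E_sum : \sum_i E i = 1%:M.
Hypothesis E_L : spec E l = L.
Notation mu := (@lebesgue_measure R).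

Let l_gt0 i : l i != 0 -> 0 < l i.
Proof. by move=> li0; rewrite lt_neqAle eq_sym li0 (laplacian_eigenvalue_ge0 gw). Qed.

Let tau_l i : tau * l i < pi / 2.
Proof. by apply: le_lt_trans taul; rewrite ler_wpM2l// maxl.2. Qed.

Let weight i := \sum_k sigma k ^+ 2 * (B^T *m E i *m B) k k.

(** At om = 0 the matrix to invert is L, which is singular. At other frequencies the zero mode
    contributes i om, is invertible, and is then removed by the centering. *)
Let h2E om : om != 0 -> h2_integrand L B sigma tau om =
  \sum_(i | l i != 0) weight i * (modal_den tau (l i) om)^-1.
Proof.
move=> om0; have cE := centering_spec gw n0 cw E_orth E_tr E_sum E_L.
have d0 i : Complex 0 om + Complex (cos (tau * om)) (- sin (tau * om)) * (l i)%:C%C != 0.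
  have [li0|li0] := eqVneq (l i) 0.
    by rewrite li0 mulr0 addr0 eq_complex /= negb_and om0 orbT.
  have := modal_den_gt0 tau0 (l_gt0 li0) (tau_l i) om.
  apply: contraTneq => /eqP; rewrite eq_complex /= => /andP[/eqP z1 /eqP z2].
  have -> : modal_den tau (l i) om =
      (0 + (cos (tau * om) * l i - - sin (tau * om) * 0)) ^+ 2
      + (om + (cos (tau * om) * 0 + - sin (tau * om) * l i)) ^+ 2.
    have cs : l i ^+ 2 = l i ^+ 2 * (cos (tau * om) ^+ 2 + sin (tau * om) ^+ 2).
      by rewrite cos2Dsin2 mulr1.
    by rewrite /modal_den cs; ring.
  by rewrite z1 z2 expr0n addr0 ltxx.
rewrite -E_L (h2_integrand_spec E_orth E_tr E_sum B sigma cE d0).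
rewrite [RHS]big_mkcond; apply: eq_bigr => i _.
rewrite -/(modal_den tau (l i) om) -/(weight i); case: (l i != 0).
  by rewrite expr1n mul1r mulrC.
by rewrite expr0n !mul0r.
Qed.

(** The null set {0} is removed to replace the integrand by its modal expansion [g], then put back
    to integrate each mode over the whole line. *)
Let integral_h2 : (\int[mu]_om (h2_integrand L B sigma tau om)%:E =
  (\sum_(i | l i != 0) weight i * (pi * (delayQ (tau * l i) / l i)))%:E)%E.
Proof.
pose f i (om : R) : \bar R := if (l i == 0)%R then 0%E else
  ((weight i)%:E * ((modal_den tau (l i) om)^-1)%:E)%E.
pose g om := (\sum_i f i om)%E.
have gE om : om != 0 -> (h2_integrand L B sigma tau om)%:E = g om.
  move=> om0; rewrite h2E// /g -sumEFin big_mkcond; apply: eq_bigr => i _.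
  by rewrite /f; case: (l i == 0).
have gi i : mu.-integrable setT (f i).
  rewrite /f; have [li0|li0] := eqVneq (l i) 0; first exact: integrable0.
  apply: integrableZl => //.
  exact: integrable_modal_denV tau0 (l_gt0 li0) (tau_l i).
have gint : mu.-integrable setT g by exact: integrable_sum.
have mg : measurable_fun (setT `\ (0 : R)) g.
  by apply: measurable_funTS; case/integrableP: gint.
have m0 : measurable (setT `\ (0 : R)) by apply: measurableD => //; exact: measurable_set1.
rewrite -(@integral_setD1 _ _ 0)//; last first.
  apply: eq_measurable_fun mg => om; rewrite inE => -[_ /eqP om0].
  by rewrite gE.
transitivity (\int[mu]_(om in setT `\ (0 : R)%R) g om)%E.
  by apply: eq_integral => om; rewrite inE => -[_ /eqP om0]; rewrite gE.
rewrite integral_setD1// /g integral_sum//.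
rewrite -sumEFin [RHS]big_mkcond; apply: eq_bigr => i _; rewrite /f.
have [li0|li0] /= := eqVneq (l i) 0; first exact: integral0.
rewrite integralZl//; last exact: integrable_modal_denV tau0 (l_gt0 li0) (tau_l i).
by rewrite (integral_modal_denV tau0 (l_gt0 li0) (tau_l i)) -EFinM.
Qed.

(** On a nonzero mode [H] has the factor cos (tau l) / (l (1 - sin (tau l))); on the zero mode the
    pseudo-inverse of L gives 0. The prefactor 1 / (2 pi) and the pi of the modal integral leave 1 /
    2. *)
Lemma rho_ss_spectral :
  let H := B^T *m mp_pinv L *m mx_cos (tau *: L)
             *m mp_pinv (@centering R n - mx_sin (tau *: L)) *m B in
  rho_ss L B sigma tau = (\sum_(k < m) (2^-1 * H k k) * sigma k ^+ 2)%:E.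
Proof.
move=> H; rewrite /rho_ss integral_h2 -EFinM; congr EFin.
have HE : H = B^T *m spec E (fun i => if l i == 0 then 0 else delayQ (tau * l i) / l i) *m B.
  rewrite /H (centering_spec gw n0 cw E_orth E_tr E_sum E_L) -E_L specZ.
  rewrite mx_cos_spec// mx_sin_spec// specB !mp_pinv_spec// -!mulmxA; congr (_ *m _).
  rewrite !mulmxA !specM//; congr (_ *m _); apply: eq_spec => i.
  have [->|li0] := eqVneq (l i) 0; first by rewrite invr0 !mul0r.
  by rewrite /delayQ /=; ring.
under [RHS]eq_bigr do rewrite HE quad_spec mulr_sumr mulr_suml.
rewrite exchange_big /= mulr_sumr big_mkcond /=; apply: eq_bigr => i _.
have [li0|li0] := eqVneq (l i) 0.
  by rewrite big1// => k _; rewrite mul0r mulr0 mul0r.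
have pi0 : pi != 0 :> R by rewrite gt_eqF// pi_gt0.
rewrite /weight mulr_suml mulr_sumr; apply: eq_bigr => k _.
by move: pi pi0 => p p0; field; rewrite li0 p0.
Qed.

End Main.

Unset Implicit Arguments.

Theorem theorem2 (R : realType) (n m : nat) (w : 'I_n -> 'I_n -> R)
    (B : 'M[R]_(n, m)) (sigma : 'I_m -> R) (tau lambda_n : R) :
  (0 < n)%N ->
  is_wgraph w -> wconnected w ->
  0 <= tau ->
  largest_eigenvalue (laplacian w) lambda_n ->
  tau * lambda_n < pi / 2 ->
  let L := laplacian w in
  let H := B^T *m mp_pinv L *m mx_cos (tau *: L)
             *m mp_pinv (@centering R n - mx_sin (tau *: L)) *m B in
  rho_ss L B sigma tau = (\sum_(k < m) (2^-1 * H k k) * sigma k ^+ 2)%:E.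
Proof.
(* The spectral resolution is stated for size [n.+1]; size 0 contradicts the positivity
   hypothesis. *)
case: n w B => [//|n] w B n0 gw cw tau0 maxl taul L H.
have [r [l [E [l_eigen E_tr E_orth E_sum E_L]]]] :=
  symmetric_spectral_resolution (laplacian_sym gw).
exact: (rho_ss_spectral B sigma n0 gw cw tau0 maxl taul l_eigen E_tr E_orth E_sum E_L).
Qed.
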